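(* Fix integers $a,b,c,d\ge 0$ with $a+d\ge 1$, $b\ge 1$, $c\ge 1$ and $\gcd(b,c,a+d)=1$, and fix an integer $m\ge 0$. Let $\rho$ be the smallest positive root of $(1-z^b)(1-z^c)^2-4z^{a+d}$. Then there exist positive constants $\underline{C}$ and $\overline{C}$ (depending on $a,b,c,d$ and $m$) such that the number $[z^n]L_m(z)$ of $m$-open lambda terms of size $n$ satisfies \[ \liminf_{n\to\infty}\frac{[z^n]L_m(z)}{\underline{C}\,n^{-3/2}\rho^{-n}}\ge 1 \quad\text{and}\quad \limsup_{n\to\infty}\frac{[z^n]L_m(z)}{\overline{C}\,n^{-3/2}\rho^{-n}}\le 1 . \]
   Context: Lambda terms are considered in De Bruijn notation: words generated by $M ::= n \mid \lambda M \mid M\,N$ with $n$ a positive integer (De Bruijn index); the index $n$ is written as $S^{n-1}0$ ($n-1$ successors $S$ followed by a zero $0$). The size of a term is defined by $|0|=a$, $|S\,n|=|n|+b$, $|\lambda M|=|M|+c$, $|M\,N|=|M|+|N|+d$. A term is $m$-open if a prefix of at most $m$ abstractions $\lambda$ suffices to close it, i.e. every occurrence of an index $n$ lies in the scope of at least $n-m$ abstractions. $L_m(z)=\sum_{n\ge0}L_{m,n}z^n$, where $L_{m,n}$ is the number of $m$-open lambda terms of size $n$; these series satisfy $L_m(z)=z^a\sum_{j=0}^{m-1}z^{bj}+z^cL_{m+1}(z)+z^dL_m(z)^2$. In particular $L_0$ counts closed lambda terms. *)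

(* Defs.v *)
From HB Require Import structures.
From mathcomp Require Import all_boot all_order all_algebra finmap zify.
From mathcomp Require Import all_classical all_reals all_analysis.

Set Implicit Arguments.
Unset Strict Implicit.
Unset Printing Implicit Defensive.

Import Order.TTheory GRing.Theory Num.Theory.

Local Open Scope classical_set_scope.
Local Open Scope nat_scope.

(* [Var j] is the De Bruijn index j + 1, i.e. the word S^j 0. *)
Inductive term : Type :=
| Var of nat
| Lam of term
| App of term & term.

Fixpoint tree_of_term (t : term) : GenTree.tree nat :=
  match t with
  | Var j => GenTree.Leaf j
  | Lam u => GenTree.Node 0 [:: tree_of_term u]
  | App u v => GenTree.Node 1 [:: tree_of_term u; tree_of_term v]
  end.

Fixpoint term_of_tree (t : GenTree.tree nat) : option term :=
  match t with
  | GenTree.Leaf j => Some (Var j)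
  | GenTree.Node 0 [:: u] => omap Lam (term_of_tree u)
  | GenTree.Node 1 [:: u; v] =>
      obind (fun u' => omap (App u') (term_of_tree v)) (term_of_tree u)
  | _ => None
  end.

Lemma tree_of_termK : pcancel tree_of_term term_of_tree.
Proof. by elim=> //= [u -> | u -> v ->]. Qed.

HB.instance Definition _ := Countable.copy term (pcan_type tree_of_termK).

Fixpoint index_size (a b j : nat) : nat :=
  if j is j'.+1 then index_size a b j' + b else a.

Fixpoint term_size (a b c d : nat) (t : term) : nat :=
  match t with
  | Var j => index_size a b j
  | Lam u => term_size a b c d u + c
  | App u v => term_size a b c d u + term_size a b c d v + d
  end.

(* [k] is the number of abstractions enclosing [t]. *)
Fixpoint open_under (m k : nat) (t : term) : bool :=
  match t with
  | Var j => j.+1 - m <= k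
  | Lam u => open_under m k.+1 u
  | App u v => open_under m k u && open_under m k v
  end.

Definition m_open (m : nat) (t : term) : bool := open_under m 0 t.

Definition open_terms (a b c d m n : nat) : set term :=
  [set t | m_open m t /\ term_size a b c d t = n].

(* [fset_set] is [fset0] on infinite sets; [finite_open_terms] below rules
   this case out when 1 <= a + d, 1 <= b and 1 <= c. *)
Definition num_open_terms (a b c d m n : nat) : nat :=
  (#|` fset_set (open_terms a b c d m n)|)%fset.

Lemma index_sizeE (a b j : nat) : index_size a b j = a + b * j.
Proof. by elim: j => [|j /= ->]; [rewrite muln0 addn0 | rewrite mulnS; lia]. Qed.

Lemma term_size_ge (a b c d : nat) (t : term) : a <= term_size a b c d t.
Proof. by elim: t => /= [j | u | u ? v ?]; rewrite ?index_sizeE; lia. Qed.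

Lemma finite_open_terms (a b c d m n : nat) :
  1 <= a + d -> 1 <= b -> 1 <= c -> finite_set (open_terms a b c d m n).
Proof.
move=> ad b1 c1; pose T N := [set t | term_size a b c d t < N].
suff fT N : finite_set (T N).
  by apply: sub_finite_set (fT n.+1) => t [_ <-]; rewrite /T /= ltnSn.
elim: N => [|N fT]; first by rewrite (_ : T 0 = set0) // -subset0 => t.
pose U := Var @` `I_N.+1 `|` Lam @` T N `|` [set App u v | u in T N & v in T N].
have: finite_set U.
  rewrite /U !finite_setU; split; first by split; apply: finite_image.
  exact: finite_image2.
apply: sub_finite_set => -[j | u | u v]; rewrite /T /=.
- rewrite index_sizeE => jN; left; left; exists j => //=; nia.
- by move=> uN; left; right; exists u => //; rewrite /T /=; lia.
- have := term_size_ge a b c d u; have := term_size_ge a b c d v.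
  by move=> *; right; exists u; [|exists v => //]; rewrite /T /=; lia.
Qed.

Local Open Scope ring_scope.

Definition sing_poly (R : realType) (a b c d : nat) : {poly R} :=
  (1 - 'X^b) * (1 - 'X^c) ^+ 2 - 4%:R *: 'X^(a + d).

Definition smallest_positive_root (R : realType) (p : {poly R}) (r : R) : Prop :=
  [/\ 0 < r, root p r & forall x : R, 0 < x -> root p x -> r <= x].

(* Main.v *)
Require Import Defs.
From HB Require Import structures.
From mathcomp Require Import all_boot all_order all_algebra finmap zify ring lra.
From mathcomp Require Import all_classical all_reals all_analysis.

Set Implicit Arguments.
Unset Strict Implicit.
Unset Printing Implicit Defensive.

Import Order.TTheory GRing.Theory Num.Theory.

Local Open Scope ring_scope.

(** Rescale sizes so that [z = rho Z], and write [t] for the generating function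
    of all terms. Splitting by the number of applications gives
    [t = V G sum_k Cat_k (W / 4)^k], where [V] and [G] are geometric series and
    [W] is a power series with nonnegative coefficients of sum 1: the critical
    value of the Catalan series is reached exactly at [rho]. Since
    [Cat_k / 4^k] is of order [k^(-3/2)], the n-th coefficient of [t] is of
    order [n^(-3/2)] as soon as the renewal sequence [1 / (1 - W)] is bounded
    above and eventually bounded below. The latter needs no renewal theorem: the
    renewal identity with the tails of [W] forces a large value in every window
    of fixed length, and supermultiplicativity together with
    [gcd (b, c, a + d) = 1] propagates it to every large index.

    For m-open terms, the terms that are not N-open are counted, up to
    multiplicity, by marking an offending index. The path from the root to the
    mark gives [Z^(bN) V / (1 - Z^(b + c) - 2 Z^(a + d) t)]. This is subcritical at
    [rho], so its coefficients are again of order [n^(-3/2)], with the factor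
    [rho^(bN)] in front: for large N most terms are N-open. Finally, prefixing N
    abstractions to an (m + N)-open term makes it m-open. *)

(** * Formal power series *)

Definition fps (R : Type) : Type := nat -> R.

HB.instance Definition _ (R : zmodType) := GRing.Zmodule.copy (fps R) (nat -> R).

Section FpsRing.
Variable R : comNzRingType.
Implicit Types f g h : fps R.

Definition fps_one : fps R := fun n => (n == 0%N)%:R.

Definition fps_mul f g : fps R := fun n => \sum_(i < n.+1) f i * g (n - i)%N.

Let trunc N f : {poly R} := \poly_(i < N) f i.

(** A coefficient of a product sees finitely many coefficients of the factors, so the ring laws are
    inherited from polynomials. *)
Let fps_mul_trunc N f g i : (i < N)%N ->
  fps_mul f g i = (trunc N f * trunc N g)`_i.
Proof.
move=> iN; rewrite coefM; apply: eq_bigr => j _; rewrite !coef_poly.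
by rewrite !ifT //; have := ltn_ord j; lia.
Qed.

Lemma fps_mulA : associative fps_mul.
Proof.
move=> f g h; apply/funext => n.
transitivity ((trunc n.+1 f * (trunc n.+1 g * trunc n.+1 h))`_n).
  rewrite coefM; apply: eq_bigr => i _.
  by rewrite coef_poly ltn_ord (@fps_mul_trunc n.+1)// ltnS leq_subr.
rewrite mulrA coefM; apply: eq_bigr => i _.
by rewrite coef_poly ltnS leq_subr (@fps_mul_trunc n.+1).
Qed.

Lemma fps_mulC : commutative fps_mul.
Proof. by move=> f g; apply/funext => n; rewrite !(@fps_mul_trunc n.+1)// mulrC. Qed.

Lemma fps_mul1 : left_id fps_one fps_mul.
Proof.
move=> f; apply/funext => n; rewrite /fps_mul big_ord_recl /= mul1r subn0.
by rewrite big1 ?addr0// => i _; rewrite /fps_one /= mul0r.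
Qed.

Lemma fps_mulDl : left_distributive fps_mul +%R.
Proof.
move=> f g h; apply/funext => n; rewrite /fps_mul.
rewrite [RHS](_ : _ = \sum_(i < n.+1) f i * h (n - i)%N
                    + \sum_(i < n.+1) g i * h (n - i)%N)//.
by rewrite -big_split; apply: eq_bigr => i _; exact: mulrDl.
Qed.

Lemma fps_one_neq0 : fps_one != 0.
Proof.
by apply/eqP => /(congr1 (fun f => f 0%N)) /eqP; rewrite /fps_one /= oner_eq0.
Qed.

HB.instance Definition _ := GRing.Zmodule_isComNzRing.Build (fps R)
  fps_mulA fps_mulC fps_mul1 fps_mulDl fps_one_neq0.

Definition fpsX : fps R := fun n => (n == 1%N)%:R.
Definition fpsC (x : R) : fps R := fun n => if n is 0 then x else 0.

Lemma coef_fpsD f g n : (f + g) n = f n + g n. Proof. by []. Qed.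
Lemma coef_fpsN f n : (- f) n = - f n. Proof. by []. Qed.
Lemma coef_fpsM f g n : (f * g) n = \sum_(i < n.+1) f i * g (n - i)%N.
Proof. by []. Qed.
Lemma coef_fps1 n : (1 : fps R) n = (n == 0%N)%:R. Proof. by []. Qed.

Lemma coef_fps_sum (I : Type) (s : seq I) (P : pred I) (F : I -> fps R) n :
  (\sum_(i <- s | P i) F i) n = \sum_(i <- s | P i) F i n.
Proof. exact: (big_morph (fun f : fps R => f n)). Qed.

Lemma coef_fpsCM x f n : (fpsC x * f) n = x * f n.
Proof.
rewrite coef_fpsM big_ord_recl subn0 big1 ?addr0// => i _.
by rewrite mul0r.
Qed.

Lemma coef_fpsXM f n : (fpsX * f) n = if n is n'.+1 then f n' else 0.
Proof.
rewrite coef_fpsM; case: n => [|n]; first by rewrite big_ord1 mul0r.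
rewrite big_ord_recl mul0r add0r big_ord_recl mul1r subSS subn0.
by rewrite big1 ?addr0// => i _; rewrite mul0r.
Qed.

Lemma coef_fpsXnM k f n :
  (fpsX ^+ k * f) n = if (k <= n)%N then f (n - k)%N else 0.
Proof.
elim: k n => [|k IH] n; first by rewrite expr0 mul1r subn0.
by rewrite exprS -mulrA coef_fpsXM; case: n => [|n]//; rewrite IH.
Qed.

Lemma fpsCD x y : fpsC (x + y) = fpsC x + fpsC y.
Proof. by apply/funext => -[|n]; rewrite coef_fpsD //= addr0. Qed.

Lemma fpsC1 : fpsC 1 = 1.
Proof. by apply/funext => -[|n]. Qed.

Lemma fpsCM x y : fpsC (x * y) = fpsC x * fpsC y.
Proof. by apply/funext => n; rewrite coef_fpsCM; case: n => [|n]//=; rewrite mulr0. Qed.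

Lemma fpsCX x k : fpsC (x ^+ k) = fpsC x ^+ k.
Proof. by elim: k => [|k IH]; rewrite ?fpsC1// !exprS fpsCM IH. Qed.

End FpsRing.

(** * Substitution of power series *)

Section FpsComp.
Variable R : comNzRingType.
Implicit Types f g k l : fps R.

Lemma coef_fpsX_eq0 f i n : f 0%N = 0 -> (n < i)%N -> (f ^+ i) n = 0.
Proof.
move=> f0 ni; pose g : fps R := fun n => f n.+1.
have -> : f = fpsX R * g by apply/funext => -[|m]; rewrite coef_fpsXM.
by rewrite exprMn coef_fpsXnM leqNgt ni.
Qed.

Lemma eq_coef_fpsM f f' g g' n :
  (forall i, (i <= n)%N -> f i = f' i) -> (forall i, (i <= n)%N -> g i = g' i) ->
  (f * g) n = (f' * g') n.
Proof.
move=> ff gg; rewrite !coef_fpsM; apply: eq_bigr => i _.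
by rewrite ff ?gg ?leq_subr// -ltnS.
Qed.

(* The substitution [k(f)]; it is meaningful only when [f 0 = 0], which makes
   the truncation of the sum at [n] harmless. *)
Definition fps_comp k f : fps R := fun n => \sum_(i < n.+1) k i * (f ^+ i) n.

Section Fixed.
Variable f : fps R.
Hypothesis f0 : f 0%N = 0.

Lemma coef_fps_comp k N n : (n < N)%N ->
  fps_comp k f n = (\sum_(i < N) fpsC (k i) * f ^+ i) n.
Proof.
move=> nN; rewrite coef_fps_sum /fps_comp.
under [RHS]eq_bigr do rewrite coef_fpsCM.
rewrite (big_ord_widen _ (fun i => k i * (f ^+ i) n) nN) big_mkcond /=.
apply: eq_bigr => i _; case: ltnP => // ni.
by rewrite (coef_fpsX_eq0 f0 ni) mulr0.
Qed.

Lemma fps_compD k l : fps_comp (k + l) f = fps_comp k f + fps_comp l f.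
Proof.
apply/funext => n; rewrite coef_fpsD /fps_comp -big_split.
by apply: eq_bigr => i _; exact: mulrDl.
Qed.

Lemma fps_compC x : fps_comp (fpsC x) f = fpsC x.
Proof.
apply/funext => n; rewrite /fps_comp big_ord_recl big1 => [|i _]; last first.
  by rewrite mul0r.
by rewrite addr0 expr0 coef_fps1; case: n => [|n]; rewrite ?mulr1 ?mulr0.
Qed.

Lemma fps_compX : fps_comp (fpsX R) f = f.
Proof.
apply/funext => n; rewrite (@coef_fps_comp _ n.+2)// coef_fps_sum.
rewrite big_ord_recl coef_fpsCM mul0r add0r big_ord_recl coef_fpsCM mul1r expr1.
by rewrite big1 ?addr0// => i _; rewrite coef_fpsCM mul0r.
Qed.

Lemma fps_compM k l : fps_comp (k * l) f = fps_comp k f * fps_comp l f.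
Proof.
apply/funext => n.
pose S k' := \sum_(i < n.+1) fpsC (k' i) * f ^+ i.
rewrite [RHS](@eq_coef_fpsM _ (S k) _ (S l)); last 2 first.
- by move=> i ni; rewrite (@coef_fps_comp _ n.+1).
- by move=> i ni; rewrite (@coef_fps_comp _ n.+1).
rewrite /S mulr_suml coef_fps_sum.
transitivity (\sum_(i < n.+1) \sum_(j < n.+1) k i * l j * (f ^+ (i + j)) n);
    last first.
  apply: eq_bigr => i _; rewrite mulr_sumr coef_fps_sum; apply: eq_bigr => j _.
  by rewrite -coef_fpsCM fpsCM exprD mulrACA.
rewrite /fps_comp.
(* The triangle [j <= i] is reindexed by [(j, i - j)]. The pairs of the square with sum above [n]
   are missing, but there [f ^+ (i + j)] has no coefficient of degree [n]. *)
transitivity (\sum_(i < n.+1) \sum_(j < n.+1 | (j <= i)%N)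
    k j * l (i - j)%N * (f ^+ i) n).
  apply: eq_bigr => i _; rewrite coef_fpsM mulr_suml.
  by rewrite (big_ord_widen n.+1 (fun j => k j * l (i - j)%N * (f ^+ i) n)).
rewrite (exchange_big_dep xpredT) //=; apply: eq_bigr => i _.
rewrite -(big_geq_mkord i n.+1 xpredT (fun j => k i * l (j - i)%N * (f ^+ j) n)).
rewrite -{1}[nat_of_ord i]add0n big_addn big_mkord.
rewrite (big_ord_widen n.+1 (fun j => k i * l (j + i - i)%N * (f ^+ (j + i)) n)).
  rewrite big_mkcond; apply: eq_bigr => j _; rewrite addnK addnC.
  case: ltnP => // ij; rewrite coef_fpsX_eq0 ?mulr0//.
  by have := ltn_ord i; lia.
exact: leq_subr.
Qed.

(** Substitution is a ring homomorphism, so it carries the relation from [fpsX R] to [f]. *)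
Lemma fps_comp_geo k : (1 - fpsX R) * k = 1 -> (1 - f) * fps_comp k f = 1.
Proof.
move=> kE; have -> : 1 - f = fps_comp (1 - fpsX R) f.
  apply/eqP; rewrite subr_eq -[X in _ + X]fps_compX -fps_compD subrK.
  by rewrite -(fpsC1 R) fps_compC.
by rewrite -fps_compM kE -(fpsC1 R) fps_compC.
Qed.

Lemma fps_inv_ones : (1 - f) * fps_comp (fun=> 1) f = 1.
Proof.
apply: fps_comp_geo; rewrite mulrBl mul1r; apply/funext => n.
rewrite coef_fpsD coef_fpsN coef_fpsXM coef_fps1.
by case: n => [|n]; rewrite ?subr0 ?subrr.
Qed.

End Fixed.
End FpsComp.

(** * Weighted l1 norms and nonnegative series *)

Section WeightedNorm.
Variable R : realFieldType.
Implicit Types f g : fps R.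

(** The weighted l1 norm at radius [r], bounded through partial sums so that no infinite sum has to
    be formed. *)
Definition fps_norm_le (r : R) f (M : R) : Prop :=
  forall N, \sum_(n < N) `|f n| * r ^+ n <= M.

Lemma sum_coef_fpsM f g N :
  \sum_(n < N) (f * g) n = \sum_(i < N) f i * \sum_(j < N - i) g j.
Proof.
elim: N => [|N IH]; first by rewrite !big_ord0.
rewrite big_ord_recr IH /= coef_fpsM.
rewrite [X in _ + X]big_ord_recr [RHS]big_ord_recr /= addrA -big_split /=.
rewrite subnn subSnn big_ord1; congr (_ + _); apply: eq_bigr => i _.
rewrite subSn; last exact: ltnW.
by rewrite big_ord_recr /= mulrDr.
Qed.

Lemma le_sum_ord (F : nat -> R) m n :
  (forall i, 0 <= F i) -> (m <= n)%N -> \sum_(i < m) F i <= \sum_(i < n) F i.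
Proof.
move=> F0 mn; rewrite -!(big_mkord xpredT F) [leRHS](big_cat_nat (leq0n m) mn)//=.
by rewrite lerDl sumr_ge0.
Qed.

Lemma sum_coef_fpsM_le f g N : (forall n, 0 <= f n) -> (forall n, 0 <= g n) ->
  \sum_(n < N) (f * g) n <= (\sum_(n < N) f n) * (\sum_(n < N) g n).
Proof.
move=> f0 g0; rewrite sum_coef_fpsM mulr_suml; apply: ler_sum => i _.
by apply: ler_wpM2l => //; apply: le_sum_ord => //; exact: leq_subr.
Qed.

Lemma fps_norm_ge0 r f M : fps_norm_le r f M -> 0 <= M.
Proof. by move=> /(_ 0%N); rewrite big_ord0. Qed.

Lemma coef_le_fps_norm r f M n : 0 <= r -> fps_norm_le r f M ->
  `|f n| * r ^+ n <= M.
Proof.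
move=> r0 /(_ n.+1); rewrite big_ord_recr /=; apply: le_trans.
by rewrite lerDr sumr_ge0// => i _; rewrite mulr_ge0// exprn_ge0.
Qed.

Let absw (r : R) f : fps R := fun n => `|f n| * r ^+ n.

Let absw_ge0 r f n : 0 <= r -> 0 <= absw r f n.
Proof. by move=> r0; rewrite mulr_ge0 // exprn_ge0. Qed.

Let abswM r f g n : 0 <= r -> absw r (f * g) n <= (absw r f * absw r g) n.
Proof.
move=> r0; rewrite /absw !coef_fpsM.
apply: le_trans (ler_wpM2r (exprn_ge0 _ r0) (ler_norm_sum _ _ _)) _.
rewrite mulr_suml; apply: ler_sum => i _; rewrite normrM mulrACA -exprD.
by rewrite subnKC// -ltnS.
Qed.

Lemma fps_norm_leD r f g M M' : 0 <= r ->
  fps_norm_le r f M -> fps_norm_le r g M' -> fps_norm_le r (f + g) (M + M').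
Proof.
move=> r0 fM gM N; apply: le_trans (lerD (fM N) (gM N)).
rewrite -big_split; apply: ler_sum => i _.
by rewrite coef_fpsD /= -mulrDl ler_wpM2r ?exprn_ge0// ler_normD.
Qed.

Lemma fps_norm_leN r f M : fps_norm_le r f M -> fps_norm_le r (- f) M.
Proof.
by move=> fM N; under eq_bigr do rewrite coef_fpsN normrN; exact: fM.
Qed.

Lemma fps_norm_leM r f g M M' : 0 <= r ->
  fps_norm_le r f M -> fps_norm_le r g M' -> fps_norm_le r (f * g) (M * M').
Proof.
move=> r0 fM gM N.
apply: (@le_trans _ _ (\sum_(n < N) (absw r f * absw r g) n)).
  by apply: ler_sum => n _; exact: abswM.
apply: le_trans (sum_coef_fpsM_le _ (fun n => absw_ge0 f n r0)
  (fun n => absw_ge0 g n r0)) _.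
by apply: ler_pM; rewrite ?sumr_ge0// => i _; exact: absw_ge0.
Qed.

Lemma fps_norm_leC r x : fps_norm_le r (fpsC x) `|x|.
Proof.
case=> [|N]; first by rewrite big_ord0.
by rewrite big_ord_recl /= mulr1 big1 ?addr0// => i _; rewrite /= normr0 mul0r.
Qed.

Lemma fps_norm_le1 r : fps_norm_le r 1 1.
Proof. by rewrite -[X in fps_norm_le _ X]fpsC1 -{2}(@normr1 R); exact: fps_norm_leC. Qed.

Lemma fps_norm_leX r : 0 <= r -> fps_norm_le r (fpsX R) r.
Proof.
move=> r0 [|[|N]]; rewrite ?big_ord0 ?big_ord1 /fpsX /= ?normr0 ?mul0r//.
rewrite big_ord_recl big_ord_recl /fpsX /= normr0 normr1 mul0r add0r mul1r expr1.
by rewrite big1 ?addr0// => i _; rewrite /= ?normr0 mul0r.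
Qed.

Lemma fps_norm_le_exp r f M i : 0 <= r ->
  fps_norm_le r f M -> fps_norm_le r (f ^+ i) (M ^+ i).
Proof.
move=> r0 fM; elim: i => [|i IH]; first exact: fps_norm_le1.
by rewrite !exprS; exact: fps_norm_leM.
Qed.

(** From [g = 1 + f * g], each partial sum [S] of the norm of [g] obeys [S <= 1 + M * S], which can
    be solved since [S] is finite. *)
Lemma fps_norm_le_geo r f g M : 0 <= r -> M < 1 -> fps_norm_le r f M ->
  (1 - f) * g = 1 -> fps_norm_le r g (1 - M)^-1.
Proof.
move=> r0 M1 fM /eqP; rewrite mulrBl mul1r subr_eq => /eqP gE N.
set S := \sum_(n < N) _.
have S0 : 0 <= S by apply: sumr_ge0 => n _; exact: absw_ge0.
suff : S <= 1 + M * S by rewrite -[_^-1]mul1r ler_pdivlMr ?subr_gt0//; lra.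
have -> : S = \sum_(n < N) absw r (1 + f * g) n by rewrite -gE.
apply: (@le_trans _ _ (\sum_(n < N) (absw r 1 n + absw r (f * g) n))).
  apply: ler_sum => i _; rewrite /absw -mulrDl ler_wpM2r ?exprn_ge0//.
  exact: ler_normD.
rewrite big_split /=; apply: lerD; first exact: fps_norm_le1.
apply: (@le_trans _ _ (\sum_(n < N) (absw r f * absw r g) n)).
  by apply: ler_sum => n _; exact: abswM.
apply: le_trans (sum_coef_fpsM_le _ (fun n => absw_ge0 f n r0)
  (fun n => absw_ge0 g n r0)) _.
rewrite -gE; exact: (ler_wpM2r S0 (fM N)).
Qed.

Definition fps_nneg f : Prop := forall n, 0 <= f n.

Lemma fps_nnegM f g : fps_nneg f -> fps_nneg g -> fps_nneg (f * g).
Proof. by move=> f0 g0 n; rewrite coef_fpsM sumr_ge0// => i _; rewrite mulr_ge0. Qed.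

Lemma fps_nnegD f g : fps_nneg f -> fps_nneg g -> fps_nneg (f + g).
Proof. by move=> f0 g0 n; rewrite coef_fpsD addr_ge0. Qed.

Lemma fps_nnegC x : 0 <= x -> fps_nneg (fpsC x).
Proof. by move=> x0 [|n]. Qed.

Lemma fps_nnegX : fps_nneg (fpsX R).
Proof. by move=> n; exact: ler0n. Qed.

Lemma fps_nneg_exp f i : fps_nneg f -> fps_nneg (f ^+ i).
Proof.
move=> f0; elim: i => [|i IH]; first by move=> n; exact: ler0n.
by rewrite exprS; exact: fps_nnegM.
Qed.

Lemma fps_nneg_comp k f : fps_nneg k -> fps_nneg f -> fps_nneg (fps_comp k f).
Proof.
by move=> k0 f0 n; rewrite sumr_ge0// => i _; rewrite mulr_ge0//; exact: fps_nneg_exp.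
Qed.

Lemma coef_geo f g n : f 0%N = 0 -> (1 - f) * g = 1 ->
  g n = (n == 0%N)%:R + \sum_(j < n) f j.+1 * g (n - j.+1)%N.
Proof.
move=> f0 /eqP; rewrite mulrBl mul1r subr_eq => /eqP {1}->.
by rewrite coef_fpsD coef_fps1 coef_fpsM big_ord_recl f0 mul0r add0r.
Qed.

Lemma fps_nneg_geo f g : f 0%N = 0 -> (1 - f) * g = 1 ->
  fps_nneg f -> fps_nneg g.
Proof.
move=> f0 gE fn; elim/ltn_ind => n IH; rewrite (coef_geo _ f0 gE).
rewrite addr_ge0// sumr_ge0// => j _; rewrite mulr_ge0// IH//.
by have := ltn_ord j; lia.
Qed.

End WeightedNorm.

(** * Catalan numbers and the power n^(-3/2) *)

Section Catalan.
Variable R : rcfType.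

(* The n-th Catalan number divided by 4^n. *)
Fixpoint catw (n : nat) : R :=
  if n is n'.+1 then catw n' * ((n'.*2.+1)%:R / (n'.*2 + 4)%:R) else 1.

Definition fps_catw : fps R := catw.

Lemma catw_gt0 n : 0 < catw n.
Proof. by elim: n => //= n IH; rewrite mulr_gt0// divr_gt0// ltr0n; lia. Qed.

Lemma catwS n : (2 * n%:R + 4) * catw n.+1 = (2 * n%:R + 1) * catw n.
Proof.
rewrite /= -!muln2 natrD -(natr1 (n * 2)%N) natrM.
have := ler0n R n; move: (catw n) (n%:R) => x t t0; field; lra.
Qed.

(* The Euler operator [f -> (X f)'] turns the hypergeometric recurrence into a
   linear equation, from which Segner's convolution identity follows. *)
Lemma catw_conv n : (fps_catw * fps_catw) n = 4 * catw n.+1.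
Proof.
pose D : fps R := fun n => n.+1%:R * catw n.
have DE : D = 1 + fpsX R * (D - fpsC 2^-1 * fps_catw).
  apply/funext => -[|i]; rewrite coef_fpsD coef_fpsXM coef_fps1 /D.
    by rewrite mulr1 addr0.
  rewrite coef_fpsD coef_fpsN coef_fpsCM add0r.
  have := catwS i; rewrite /fps_catw -(natr1 i.+1) -(natr1 i).
  by move: (catw i) (catw i.+1) => x y; lra.
(* Adding the convolution to its mirror image turns the weight [j + 1] into
   [(j + 1) + (i - j + 1) = i + 2]. *)
have sym i : 2 * (D * fps_catw) i = (i%:R + 2) * (fps_catw * fps_catw) i.
  rewrite mulr_natl mulr2n {2}(mulrC D) !coef_fpsM mulr_sumr -big_split.
  apply: eq_bigr => j _; rewrite /D /= /fps_catw.
  have -> : (i%:R : R) = j%:R + (i - j)%:R by rewrite -natrD subnKC// -ltnS.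
  rewrite -!natr1; ring.
have step i : (i%:R + 3) * (fps_catw * fps_catw) i.+1 =
    2 * catw i.+1 + (i%:R + 1) * (fps_catw * fps_catw) i.
  have DM : D * fps_catw =
      fps_catw + fpsX R * (D * fps_catw - fpsC 2^-1 * (fps_catw * fps_catw)).
    by rewrite {1}DE; ring.
  have Ei := sym i; have := sym i.+1.
  rewrite {1}DM coef_fpsD coef_fpsXM coef_fpsD coef_fpsN coef_fpsCM -(natr1 i).
  move: Ei; move: ((D * fps_catw) i) ((fps_catw * fps_catw) i).
  move: ((fps_catw * fps_catw) i.+1); rewrite /fps_catw.
  by move: (catw i.+1) => w x y z; lra.
elim: n => [|n IH].
  have := catwS 0; rewrite coef_fpsM big_ord1 /fps_catw [catw 0]/=; lra.
have := step n; rewrite {}IH; have := catwS n.+1; rewrite -(natr1 n) => E1 E2.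
have n3 : n%:R + 3 != 0 :> R by rewrite -natrD pnatr_eq0; lia.
apply: (mulfI n3); rewrite E2.
move: E1; move: (catw n.+1) (catw n.+2) => x y; lra.
Qed.

Lemma fps_catwE : fps_catw = 1 + fpsC 4^-1 * (fpsX R * (fps_catw * fps_catw)).
Proof.
apply/funext => -[|n]; rewrite coef_fpsD coef_fpsCM coef_fpsXM coef_fps1.
  by rewrite mulr0 addr0.
by rewrite add0r catw_conv mulrA mulVf ?mul1r// pnatr_eq0.
Qed.

(** The left-hand side is nonincreasing in [n] and starts at 1. *)
Lemma catw_sqr_le n : catw n ^+ 2 * n.+1%:R ^+ 3 <= 1.
Proof.
elim: n => [|n IH]; first by rewrite /= !expr1n mulr1.
apply: le_trans IH; have := catwS n.
rewrite -(natr1 n.+1) -(natr1 n); have : 0 <= n%:R :> R by [].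
have := catw_gt0 n; have := catw_gt0 n.+1.
move: (catw n) (catw n.+1) (n%:R) => x y t y0 x0 t0 E.
have t4 : 2 * t + 4 != 0 by lra.
have -> : y = (2 * t + 1) * x / (2 * t + 4) by rewrite -E mulrAC mulfV ?mul1r.
rewrite -subr_ge0.
have -> : x ^+ 2 * (t + 1) ^+ 3 -
  ((2 * t + 1) * x / (2 * t + 4)) ^+ 2 * (t + 1 + 1) ^+ 3 =
  x ^+ 2 / 4 * (3 * t + 2) by field; lra.
by rewrite mulr_ge0 ?divr_ge0 ?sqr_ge0//; lra.
Qed.

Lemma catw_sqr_ge n : 1 <= 4 * (catw n ^+ 2 * n.+1%:R ^+ 3).
Proof.
(* With one factor [n + 1] lowered to [n + 1/4], the sequence becomes nondecreasing and starts at
   1. *)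
suff H : 1 <= 4 * (catw n ^+ 2 * (n.+1%:R ^+ 2 * (n%:R + 4^-1))).
  apply: le_trans H _; rewrite ler_wpM2l// ler_wpM2l ?sqr_ge0// [leRHS]exprSr.
  rewrite ler_wpM2l ?sqr_ge0// -(natr1 n); lra.
elim: n => [|n IH]; first by rewrite /= !expr1n; lra.
apply: le_trans IH _; have := catwS n.
rewrite -(natr1 n.+1) -(natr1 n); have : 0 <= n%:R :> R by [].
have := catw_gt0 n; have := catw_gt0 n.+1.
move: (catw n) (catw n.+1) (n%:R) => x y t y0 x0 t0 E.
have t4 : 2 * t + 4 != 0 by lra.
have -> : y = (2 * t + 1) * x / (2 * t + 4) by rewrite -E mulrAC mulfV ?mul1r.
rewrite -subr_ge0.
have -> : 4 * (((2 * t + 1) * x / (2 * t + 4)) ^+ 2 * ((t + 1 + 1) ^+ 2 * (t + 1 + 4^-1)))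
  - 4 * (x ^+ 2 * ((t + 1) ^+ 2 * (t + 4^-1))) =
  x ^+ 2 / 4 by field; lra.
by rewrite divr_ge0 ?sqr_ge0.
Qed.

(** The power [(n + 1)^(-3/2)]; the shift by one avoids the singular value at 0. *)
Definition pow32 (n : nat) : R := (Num.sqrt n.+1%:R) ^- 3.

Lemma pow32_gt0 n : 0 < pow32 n.
Proof. by rewrite invr_gt0 exprn_gt0// sqrtr_gt0 ltr0n. Qed.

Lemma pow32_0 : pow32 0 = 1.
Proof. by rewrite /pow32 sqrtr1 expr1n invr1. Qed.

Lemma pow32_sqr n : pow32 n ^+ 2 * n.+1%:R ^+ 3 = 1.
Proof.
rewrite /pow32 exprVn -exprM mulnC exprM sqr_sqrtr ?ler0n//.
by rewrite mulVf// expf_neq0// pnatr_eq0.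
Qed.

Lemma pow32_le (g : R) k n : 0 <= g -> n.+1%:R <= g ^+ 2 * k.+1%:R ->
  pow32 k <= g ^+ 3 * pow32 n.
Proof.
move=> g0 nk; rewrite /pow32 ler_pdivlMr ?exprn_gt0 ?sqrtr_gt0 ?ltr0n//.
rewrite mulrC ler_pdivrMr ?exprn_gt0 ?sqrtr_gt0 ?ltr0n// -exprMn.
rewrite lerXn2r ?nnegrE ?mulr_ge0 ?sqrtr_ge0//.
by rewrite -{1}(ger0_norm g0) -sqrtr_sqr -sqrtrM ?sqr_ge0// ler_wsqrtr.
Qed.

Lemma catw_le n : catw n <= pow32 n.
Proof.
have c0 := ltW (catw_gt0 n); have p0 := ltW (pow32_gt0 n).
rewrite -(ler_pXn2r (ltn0Sn 1)) ?nnegrE//.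
have n0 : 0 < n.+1%:R ^+ 3 :> R by rewrite exprn_gt0 ?ltr0n.
by rewrite -(ler_pM2r n0) pow32_sqr catw_sqr_le.
Qed.

Lemma catw_ge n : pow32 n <= 2 * catw n.
Proof.
have c0 := ltW (catw_gt0 n); have p0 := ltW (pow32_gt0 n).
rewrite -(ler_pXn2r (ltn0Sn 1)) ?nnegrE ?mulr_ge0//.
have n0 : 0 < n.+1%:R ^+ 3 :> R by rewrite exprn_gt0 ?ltr0n.
rewrite -(ler_pM2r n0) pow32_sqr exprMn.
by have := catw_sqr_ge n; move: (catw n ^+ 2) (_ ^+ 3) => x y; lra.
Qed.

End Catalan.

(** * Renewal sequences *)

(** This lets a slightly larger radius absorb polynomial factors. *)
Lemma linear_le_exp (R : realFieldType) (w : R) : 1 < w ->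
  exists2 D : R, 0 < D & forall n : nat, n.+1%:R <= D * w ^+ n.
Proof.
move=> w1; have w10 : 0 < w - 1 by lra.
exists (1 + (w - 1)^-1); first by rewrite addr_gt0// invr_gt0.
elim=> [|n IH]; first by rewrite expr0 mulr1 lerDl invr_ge0 ltW.
have D1 : 1 <= (1 + (w - 1)^-1) * w ^+ n * (w - 1).
  rewrite mulrAC -[1]mulr1 ler_pM// ?exprn_ege1 ?ltW//.
  by rewrite mulrDl mul1r mulVf ?gt_eqF//; lra.
rewrite exprSr -(natr1 n.+1); move: IH D1.
by move: (_ ^+ n) (1 + _) (n.+1%:R) => x y z; lra.
Qed.

Lemma le_exp_archi (R : archiRealFieldType) (w x : R) : 1 < w ->
  exists n : nat, x <= w ^+ n.
Proof.
move=> w1; have [D D0 wD] := linear_le_exp w1.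
exists (Num.bound `|x * D|); set n := Num.bound _.
have xn : x * D <= n.+1%:R.
  apply: le_trans (ler_norm _) _; apply: ltW.
  by apply: lt_trans (archi_boundP (normr_ge0 _)) _; rewrite ltr_nat.
by have := le_trans xn (wD n); rewrite mulrC ler_pM2l.
Qed.

(** Two Bezout relations, written without subtraction, give consecutive elements [s] and [s.+1],
    which generate every integer from [s * s] on. One [e] is added to both, so that [e] always
    occurs, as it does in every monomial of [W]. *)
Lemma numerical_semigroup (b c e : nat) :
  (0 < b)%N -> (0 < c)%N -> (0 < e)%N -> gcdn (gcdn b c) e = 1%N ->
  exists M, forall n, (M <= n)%N ->
    exists k i j, (n = k.+1 * e + c * i + b * j)%N.
Proof.
move=> b0 c0 e0 g1.
have [x _ /dvdnP[y E1]] := Bezoutl b c0.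
have gbc0 : (0 < gcdn b c)%N by rewrite gcdn_gt0 b0.
have [x' _ /dvdnP[y' E2]] := Bezoutl e gbc0.
rewrite g1 in E2; rewrite gcdnC in E1.
(* [s] and [s.+1] both lie in the semigroup. *)
pose s := ((x'.+1) * e + b * (y' * x))%N.
have sE : (s.+1 = 1 * e + c * (y' * y))%N by rewrite /s; nia.
have s0 : (0 < s)%N by rewrite /s; nia.
exists (s * s)%N => n ns.
have rs : (n %% s < s)%N by rewrite ltn_mod.
have qs : (s <= n %/ s)%N by rewrite leq_divRL.
have [q qE] : exists q, (n %/ s = q.+1 + n %% s)%N.
  by exists (n %/ s - n %% s).-1; lia.
(* Of the [n %/ s] copies of [s], as many as the remainder are replaced by [s.+1]. *)
have nE : (n = q.+1 * s + n %% s * s.+1)%N.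
  by rewrite {1}(divn_eq n s) qE; lia.
move: (n %% s)%N nE => t ->.
exists (q.+1 * x'.+1 + t).-1, (t * (y' * y))%N, (q.+1 * (y' * x))%N.
rewrite prednK ?addn_gt0 ?muln_gt0// sE /s; ring.
Qed.

Section Renewal.
Variable R : realType.
Variables p u : fps R.
Hypotheses (p0 : p 0%N = 0) (p_ge0 : fps_nneg p) (pu : (1 - p) * u = 1).

Lemma renewal_ge0 : fps_nneg u.
Proof. exact: fps_nneg_geo p0 pu p_ge0. Qed.

Lemma renewal0 : u 0%N = 1.
Proof. by rewrite (coef_geo _ p0 pu) big_ord0 addr0. Qed.

(** Both renewal equations are expanded over the first jump; the one at [m + n] has further
    nonnegative terms, from jumps longer than [n]. *)
Lemma renewal_super m n : u m * u n <= u (m + n)%N.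
Proof.
elim/ltn_ind: n => -[|n] IH; first by rewrite renewal0 mulr1 addn0.
rewrite addnS (coef_geo n.+1 p0 pu) (coef_geo (m + n).+1 p0 pu) !add0r mulr_sumr.
apply: (@le_trans _ _ (\sum_(j < n.+1) p j.+1 * u (m + (n - j))%N)).
  apply: ler_sum => j _; rewrite mulrCA ler_wpM2l//; apply: IH.
  by have := ltn_ord j; lia.
have -> : \sum_(j < n.+1) p j.+1 * u (m + (n - j))%N =
          \sum_(j < n.+1) p j.+1 * u ((m + n).+1 - j.+1)%N.
  by apply: eq_bigr => j _; congr (_ * u _); have := ltn_ord j; lia.
apply: (@le_sum_ord _ (fun j => p j.+1 * u ((m + n).+1 - j.+1)%N)); last by lia.
by move=> i; rewrite mulr_ge0//; exact: renewal_ge0.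
Qed.

Lemma renewal_ge j : (0 < j)%N -> p j <= u j.
Proof.
case: j => // j _; rewrite (coef_geo _ p0 pu) add0r big_ord_recr subnn renewal0 mulr1.
by rewrite lerDr sumr_ge0// => i _; rewrite mulr_ge0//; exact: renewal_ge0.
Qed.

Lemma renewal_comp : u = fps_comp (fun=> 1) p.
Proof.
by rewrite -[LHS]mulr1 -(fps_inv_ones p0) mulrCA mulrA pu mul1r.
Qed.

(** * Tail sums and the lower bound for renewal sequences *)

Section Tail.
Variables (T : fps R) (r M : R).
Hypotheses (T_ge0 : fps_nneg T) (Tp : (1 - fpsX R) * T = 1 - p).
Hypotheses (r1 : 1 < r) (TM : fps_norm_le r T M).

(** As [(1 - fpsX R) * (T * u) = (1 - p) * u = 1], the product [T * u] is the all-ones series. In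
    probabilistic terms, exactly one renewal is the last one up to time [n]. *)
Lemma renewal_tail n : \sum_(i < n.+1) T i * u (n - i)%N = 1.
Proof.
rewrite -coef_fpsM; have E : (1 - fpsX R) * (T * u) = 1 by rewrite mulrA Tp.
move: E; move: (T * u) => g /eqP; rewrite mulrBl mul1r subr_eq => /eqP gE.
elim: n => [|n IH]; rewrite gE coef_fpsD coef_fpsXM; first by rewrite addr0.
by rewrite IH add0r.
Qed.

Lemma renewal_tail0 : T 0%N = 1.
Proof. by have := renewal_tail 0; rewrite big_ord1 renewal0 mulr1. Qed.

Lemma renewal_le1 n : u n <= 1.
Proof.
rewrite -(renewal_tail n) big_ord_recl renewal_tail0 mul1r subn0 lerDl.
by rewrite sumr_ge0// => i _; rewrite mulr_ge0//; exact: renewal_ge0.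
Qed.

Lemma renewal_tail_le1 n : T n <= 1.
Proof.
elim: n => [|n IH]; first by rewrite renewal_tail0.
have := congr1 (fun g : fps R => g n.+1) Tp; rewrite mulrBl mul1r.
rewrite !coef_fpsD !coef_fpsN coef_fpsXM coef_fps1 add0r.
by have := p_ge0 n.+1; lra.
Qed.

(* Since the tail sums of [T] are small, the mass 1 of [renewal_tail] cannot
   come from the remote past only. *)
Lemma renewal_window : exists2 J : nat, (0 < J)%N &
  exists2 dl : R, 0 < dl &
    forall n, exists2 j, (j < J)%N & (j <= n)%N && (dl <= u (n - j)%N).
Proof.
(* [J'] makes the contribution from beyond the window at most [M / r ^+ J' <= 1/2]; the bound
   [1 / (2 * (J + 1))] keeps the at most [J] terms inside it strictly below 1/2 in total. *)
have [J' MJ'] := le_exp_archi (2 * M) r1.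
pose J := J'.+1; exists J => //; exists (2 * J.+1%:R)^-1.
  by rewrite invr_gt0 mulr_gt0.
move=> n; apply: contrapT => H.
have r0 : 0 < r by exact: lt_trans ltr01 r1.
have small j : (j < J)%N -> (j <= n)%N -> u (n - j)%N <= (2 * J.+1%:R)^-1.
  move=> jJ jn; rewrite leNgt; apply/negP => lt; apply: H; exists j => //.
  by rewrite jn ltW.
have rJ : 0 < r ^+ J' by rewrite exprn_gt0.
have M0 := fps_norm_ge0 TM.
have card_lt N : (\sum_(j < N) (j < J)%N <= minn N J)%N.
  elim: N => [|N IH]; first by rewrite big_ord0.
  rewrite big_ord_recr; apply: leq_trans (leq_add IH (leqnn _)) _ => /=; lia.
have : (1 : R) <= J%:R * (2 * J.+1%:R)^-1 + (r ^+ J')^-1 * M.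
  rewrite -[leLHS](renewal_tail n).
  apply: (@le_trans _ _ (\sum_(j < n.+1)
    ((j < J)%:R * (2 * J.+1%:R)^-1 + (r ^+ J')^-1 * (`|T j| * r ^+ j)))).
    apply: ler_sum => j _; have jn : (j <= n)%N by rewrite -ltnS.
    have Tr : 0 <= (r ^+ J')^-1 * (`|T j| * r ^+ j).
      by rewrite mulr_ge0 ?mulr_ge0 ?invr_ge0 ?exprn_ge0// ltW.
    have [jJ|Jj] := ltnP j J.
      apply: le_trans (_ : _ <= 1 * u (n - j)%N) _.
        by rewrite ler_wpM2r ?renewal_tail_le1//; exact: renewal_ge0.
      by rewrite !mul1r; apply: le_trans (small _ jJ jn) _; rewrite lerDl.
    rewrite mul0r add0r; apply: le_trans (_ : _ <= T j * 1) _.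
      by rewrite ler_wpM2l ?renewal_le1.
    rewrite mulr1 (ger0_norm (T_ge0 j)) mulrCA ler_peMr// mulrC ler_pdivlMr// mul1r.
    by rewrite ler_eXn2l//; exact: ltnW.
  rewrite big_split /=; apply: lerD.
    rewrite -mulr_suml ler_wpM2r ?invr_ge0 ?mulr_ge0// -natr_sum ler_nat.
    by apply: leq_trans (card_lt _) _; exact: geq_minr.
  rewrite -mulr_sumr ler_wpM2l ?invr_ge0 ?(ltW rJ)//; exact: TM.
have : (r ^+ J')^-1 * M <= 2^-1.
  by rewrite mulrC ler_pdivrMr//; lra.
have : J%:R * (2 * J.+1%:R)^-1 < 2^-1 :> R.
  by rewrite ltr_pdivrMr ?mulr_gt0// mulrA mulVf ?mul1r ?pnatr_eq0// ltr_nat.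
by move: (J%:R * _) (_ * M) => x y x2 y2 xy; lra.
Qed.

(** The window gives a large value at [n - N - j] for some [j < J]; the complementary index [N + j]
    takes finitely many values, where [u] is positive, and supermultiplicativity joins the two. *)
Lemma renewal_lower_bound :
  (exists N, forall n, (N <= n)%N -> 0 < u n) ->
  exists2 dl : R, 0 < dl & exists N, forall n, (N <= n)%N -> dl <= u n.
Proof.
move=> [N uN]; have [J _ [dl dl0 win]] := renewal_window.
have [dl' dl'0 H] : exists2 dl' : R, 0 < dl' &
    forall j, (j < J)%N -> dl' <= u (N + j)%N.
  elim: J {win} => [|J [x x0 IH]]; first by exists 1.
  exists (Num.min x (u (N + J)%N)); first by rewrite lt_min x0 uN// leq_addr.
  move=> j; rewrite ltnS leq_eqVlt => /predU1P[->|/IH xj].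
    by rewrite ge_min lexx orbT.
  by rewrite ge_min xj.
exists (dl * dl'); first exact: mulr_gt0.
exists N => n Nn; have [j jJ /andP[jn uj]] := win (n - N)%N.
have -> : (n = (n - N - j) + (N + j))%N by lia.
by apply: le_trans (renewal_super _ _); apply: ler_pM; by [|exact: ltW|exact: H].
Qed.

End Tail.
End Renewal.

(** * Transfer of the power law *)

Section PowerLaw.
Variable R : realType.
Implicit Types f g : fps R.

Local Notation pow32 := (pow32 R).

Definition fps_pow32 f : Prop := exists2 C : R, 0 < C & forall n, f n <= C * pow32 n.

Lemma pow32_lin_le (k n x : nat) : (n.+1 <= x * k.+1)%N ->
  pow32 k <= x%:R ^+ 3 * pow32 n.
Proof.
move=> nk; apply: pow32_le => //; rewrite -natrX -natrM ler_nat; nia.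
Qed.

Lemma pow32_inv_le n : 1 <= n.+1%:R ^+ 3 * pow32 n.
Proof. by rewrite -[leLHS](pow32_0 R); apply: pow32_lin_le; rewrite muln1. Qed.

Lemma pow32_antimono k n : (k <= n)%N -> pow32 n <= pow32 k.
Proof.
move=> kn; rewrite -[leRHS]mul1r -(expr1n _ 3); apply: pow32_le => //.
by rewrite expr1n mul1r ler_nat.
Qed.

(** Moving from [n - i] to [n] in [pow32] costs at most [(i + 1)^3], which the weight
    [(w ^+ 3) ^+ i] absorbs. *)
Lemma fps_pow32_geoM (w M : R) f g : 1 < w -> fps_nneg f -> fps_norm_le (w ^+ 3) f M ->
  fps_pow32 g -> fps_pow32 (f * g).
Proof.
move=> w1 f0 fM [C C0 gC]; have [D D0 wD] := linear_le_exp w1.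
have M0 := fps_norm_ge0 fM.
exists (C * D ^+ 3 * (M + 1)); first by rewrite !mulr_gt0 ?exprn_gt0//; lra.
move=> n; rewrite coef_fpsM.
apply: (@le_trans _ _ (\sum_(i < n.+1) C * D ^+ 3 * pow32 n * (`|f i| * (w ^+ 3) ^+ i))).
  apply: ler_sum => i _; rewrite (ger0_norm (f0 i)).
  have ni : pow32 (n - i) <= i.+1%:R ^+ 3 * pow32 n.
    by apply: pow32_lin_le; have := ltn_ord i; nia.
  have iD : i.+1%:R ^+ 3 <= D ^+ 3 * (w ^+ 3) ^+ i.
    by rewrite -exprM mulnC exprM -exprMn lerXn2r ?nnegrE ?mulr_ge0 ?exprn_ge0//; lra.
  have := ler_wpM2l (ltW C0) (le_trans ni (ler_wpM2r (ltW (pow32_gt0 _ n)) iD)).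
  move=> /(le_trans (gC _)) /(ler_wpM2l (f0 i)) H; apply: (le_trans H).
  by rewrite le_eqVlt; apply/orP; left; apply/eqP; ring.
rewrite -mulr_sumr; apply: (@le_trans _ _ (C * D ^+ 3 * pow32 n * M)).
  apply: ler_wpM2l; last exact: fM.
  by rewrite !mulr_ge0 ?exprn_ge0 ?(ltW D0) ?(ltW C0) ?(ltW (pow32_gt0 _ n)).
rewrite [leRHS]mulrAC ler_wpM2l; [by []| |lra].
by rewrite !mulr_ge0 ?exprn_ge0 ?(ltW D0) ?(ltW C0) ?(ltW (pow32_gt0 _ n)).
Qed.

(* Split [sum_j f j * g (n - j)]: either [n - j] is close to [n], and the
   induction hypothesis on [g] loses less than the factor [q] gains, or [j] is
   of order [n], and the bound on [f] applies. *)
Lemma fps_pow32_geo f g (q : R) : f 0%N = 0 -> fps_nneg f -> q < 1 ->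
  fps_norm_le 1 f q -> fps_pow32 f -> (1 - f) * g = 1 -> fps_pow32 g.
Proof.
move=> f0 fn q1 fq [C C0 fC] fg.
have gn := fps_nneg_geo f0 fg fn.
have gq := fps_norm_le_geo ler01 q1 fq fg.
have q0 := fps_norm_ge0 fq.
(* [x] is so small that [gm ^+ 3 <= 1 + 7 * x], whence [gm ^+ 3 * q <= q + 7 / 8 * (1 - q) < 1]. *)
pose x := (1 - q) / 8; pose gm := 1 + x.
have x0 : 0 < x by rewrite /x; lra.
have gm1 : gm ^+ 3 * q < 1.
  have -> : gm ^+ 3 = 1 + x * (3 + 3 * x + x ^+ 2) by rewrite /gm; ring.
  have : x * (3 + 3 * x + x ^+ 2) * q <= x * 7 * 1.
    have x1 : x <= 1 by rewrite /x; lra.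
    have x2 : x ^+ 2 <= 1 by rewrite expr_le1// ltW.
    have x20 := sqr_ge0 x.
    apply: ler_pM => //; last exact: ltW.
      by apply: mulr_ge0; lra.
    by apply: ler_wpM2l; lra.
  rewrite mulrDl mul1r /x; lra.
have gm2 : 0 < gm ^+ 2 - 1 by rewrite /gm; nra.
(* If [gm ^+ 2 * (n - j) < n + 1], then [n + 1 <= th * (j + 2)]. *)
pose th := gm ^+ 2 / (gm ^+ 2 - 1).
have th1 : 1 <= th by rewrite /th ler_pdivlMr//; lra.
pose B := C * th ^+ 3 / (1 - q).
have th0 : 0 <= th by exact: le_trans ler01 th1.
have gm0 : 0 <= gm by rewrite /gm; lra.
have B0 : 0 <= B.
  apply: divr_ge0; last by rewrite subr_ge0 ltW.
  by apply: mulr_ge0; [exact: ltW|exact: exprn_ge0].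
(* [K] solves [K = 1 + B + gm ^+ 3 * q * K]; the three terms come from the coefficient at 0, the far
   indices and the near ones. *)
pose K := (1 + B) / (1 - gm ^+ 3 * q).
have K0 : 0 < K by rewrite /K divr_gt0 ?subr_gt0// ltr_pwDl.
exists K => //; elim/ltn_ind => n IH.
have pn := pow32_gt0 R n.
rewrite (coef_geo n f0 fg).
have d0 : (n == 0%N)%:R <= pow32 n.
  by case: n {IH} pn => [|n]; rewrite ?(pow32_0 R)// => /ltW.
have c1 : 0 <= gm ^+ 3 * K * pow32 n.
  by apply: mulr_ge0; [apply: mulr_ge0; [exact: exprn_ge0|exact: ltW]|exact: ltW].
have c2 : 0 <= C * th ^+ 3 * pow32 n.
  by apply: mulr_ge0; [apply: mulr_ge0; [exact: ltW|exact: exprn_ge0]|exact: ltW].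
have sum : \sum_(j < n) f j.+1 * g (n - j.+1)%N <=
    gm ^+ 3 * K * pow32 n * (\sum_(j < n) f j.+1)
    + C * th ^+ 3 * pow32 n * (\sum_(j < n) g (n - j.+1)%N).
  rewrite !mulr_sumr -big_split; apply: ler_sum => j _ /=.
  have jn : (j.+1 <= n)%N by [].
  have [near|far] := leP n.+1%:R (gm ^+ 2 * (n - j.+1).+1%:R :> R).
    have gj : g (n - j.+1)%N <= K * (gm ^+ 3 * pow32 n).
      apply: le_trans (IH _ _) _; first by rewrite ltn_subrL (leq_trans _ jn).
      by rewrite ler_wpM2l ?(ltW K0)//; apply: pow32_le near.
    apply: le_trans (ler_wpM2l (fn j.+1) gj) _.
    by rewrite mulrC [K * _]mulrA [K * _]mulrC lerDl; exact: mulr_ge0.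
  have fj : f j.+1 <= C * (th ^+ 3 * pow32 n).
    apply: le_trans (fC _) _; rewrite ler_wpM2l ?(ltW C0)//; apply: pow32_le => //.
    apply: (@le_trans _ _ (th * j.+2%:R)); last first.
      by rewrite ler_wpM2r// expr2 ler_peMr.
    rewrite /th mulrAC ler_pdivlMr//; move: far.
    rewrite subnSK//.
    rewrite natrB; last exact: ltnW.
    rewrite -(natr1 n) -(natr1 j.+1) -(natr1 j).
    have gm20 := sqr_ge0 gm.
    by move: (gm ^+ 2) (n%:R) (j%:R : R) gm20 => y z t; lra.
  apply: le_trans (ler_wpM2r (gn (n - j.+1)%N) fj) _.
  by rewrite [C * _]mulrA lerDr; exact: mulr_ge0.
have fsum : \sum_(j < n) f j.+1 <= q.
  have := fq n.+1; rewrite big_ord_recl f0 normr0 mul0r add0r; apply: le_trans.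
  by apply: ler_sum => j _; rewrite expr1n mulr1 ler_norm.
have gsum : \sum_(j < n) g (n - j.+1)%N <= (1 - q)^-1.
  rewrite (reindex_inj rev_ord_inj) /=; apply: le_trans (gq n).
  apply: ler_sum => j _; rewrite expr1n mulr1.
  by rewrite subnSK// subKn ?ler_norm// ltnW.
have KE : K = 1 + B + gm ^+ 3 * q * K.
  by rewrite /K; field; lra.
apply: le_trans (lerD d0 (le_trans sum (lerD (ler_wpM2l c1 fsum) (ler_wpM2l c2 gsum)))) _.
rewrite [in leRHS]KE le_eqVlt; apply/orP; left; apply/eqP; rewrite /B.
ring.
Qed.

Section CatalanSum.
Variables (p u T : fps R) (w M : R).
Hypotheses (p0 : p 0%N = 0) (p_ge0 : fps_nneg p) (pu : (1 - p) * u = 1).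
Hypotheses (T_ge0 : fps_nneg T) (Tp : (1 - fpsX R) * T = 1 - p).
Hypotheses (w1 : 1 < w) (pM : fps_norm_le (w ^+ 8) p M).

(** Only powers [k <= n] occur, each weighted by at least half of [pow32 n], and the unweighted sum
    of the powers of [p] is [u]. *)
Lemma catalan_sum_lower n : pow32 n * u n <= 2 * fps_comp (fps_catw R) p n.
Proof.
rewrite {1}(renewal_comp p0 pu) /fps_comp !mulr_sumr; apply: ler_sum => k _.
rewrite mul1r mulrA ler_wpM2r//; first exact: fps_nneg_exp.
by apply: le_trans (catw_ge _ _); apply: pow32_antimono; rewrite -ltnS.
Qed.

(* Catalan indices [k] much smaller than [n] contribute exponentially little by
   Chernoff's bound. *)
Lemma catalan_sum_upper : fps_pow32 (fps_comp (fps_catw R) p).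
Proof.
have [D D0 wD] := linear_le_exp w1.
have w4 : 1 < w ^+ 4 by rewrite exprn_egt1.
(* With [s = w ^+ 4], this [e] gives [M ^+ k <= s ^+ n] whenever [k * e.+1 <= n]. The norm bounds
   [(p ^+ k) n * s ^+ (2 * n)] by [M ^+ k], so such a [k] contributes at most [s ^- n]. *)
have [e Me] := le_exp_archi M w4.
have M0 := fps_norm_ge0 pM.
exists (D ^+ 4 + e.+1%:R ^+ 3); first by rewrite addr_gt0 ?exprn_gt0.
move=> n; have pn := pow32_gt0 R n.
pose s := w ^+ 4.
have w0 : 0 < w by exact: lt_trans ltr01 w1.
have s0 : 0 < s by exact: lt_trans ltr01 w4.
have sn0 : 0 < s ^+ n by exact: exprn_gt0.
have w8 : 0 <= w ^+ 8 by apply: exprn_ge0; exact: ltW.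
apply: (@le_trans _ _ (\sum_(k < n.+1)
   ((s ^+ n)^-1 + e.+1%:R ^+ 3 * pow32 n * (p ^+ k) n))).
  apply: ler_sum => k _; have pk0 : 0 <= (p ^+ k) n by exact: fps_nneg_exp.
  have e0 : 0 <= e.+1%:R ^+ 3 * pow32 n by apply: mulr_ge0; [exact: exprn_ge0|exact: ltW].
  have [ken|nke] := leqP (k * e.+1) n.
    apply: (@le_trans _ _ ((s ^+ n)^-1)); last by rewrite lerDl mulr_ge0.
    apply: (@le_trans _ _ ((p ^+ k) n)).
      rewrite ler_piMl//; apply: le_trans (catw_le _ _) _.
      by rewrite -[leRHS](pow32_0 R); exact: pow32_antimono.
    rewrite -[leRHS]mul1r ler_pdivlMr//.
    have Msn : M ^+ k <= s ^+ n.
      apply: le_trans (_ : _ <= (s ^+ e.+1) ^+ k) _.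
        apply: lerXn2r; [exact: M0|by apply: exprn_ge0; exact: ltW|].
        by apply: le_trans Me _; rewrite ler_weXn2l// ltW.
      by rewrite -exprM ler_weXn2l// ?(ltW w4)// mulnC.
    have := le_trans (coef_le_fps_norm n w8 (fps_norm_le_exp k w8 pM)) Msn.
    rewrite (ger0_norm pk0) (_ : (w ^+ 8) ^+ n = s ^+ n * s ^+ n); last first.
      by rewrite -exprMn /s -exprD.
    by rewrite mulrA -[X in _ <= X -> _]mul1r ler_pM2r.
  apply: (@le_trans _ _ (e.+1%:R ^+ 3 * pow32 n * (p ^+ k) n)); last first.
    by rewrite lerDr invr_ge0 ltW.
  rewrite ler_wpM2r//; apply: le_trans (catw_le _ _) _.
  apply: pow32_lin_le; apply: leq_trans nke _.
  by rewrite mulnC leq_mul2l leqnSn orbT.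
(* The [n + 1] exponentially small terms are absorbed through [(n + 1)^4 <= D ^+ 4 * s ^+ n]; in the
   other part, the powers of [p] sum to [u n <= 1]. *)
rewrite big_split /= sumr_const card_ord mulrDl; apply: lerD.
  rewrite -mulr_natl ler_pdivrMr//.
  have n4 : n.+1%:R ^+ 4 <= D ^+ 4 * s ^+ n.
    rewrite /s -exprM mulnC exprM -exprMn lerXn2r ?nnegrE//.
    by apply: mulr_ge0; [exact: ltW|apply: exprn_ge0; exact: ltW].
  apply: le_trans (_ : _ <= n.+1%:R ^+ 4 * pow32 n) _.
    by rewrite exprS -mulrA ler_peMr// pow32_inv_le.
  by rewrite [leRHS]mulrAC ler_wpM2r// ltW.
rewrite -mulr_sumr ler_piMr ?mulr_ge0 ?exprn_ge0 ?(ltW pn)//.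
have := renewal_le1 p0 p_ge0 pu T_ge0 Tp n.
by rewrite {1}(renewal_comp p0 pu) /fps_comp; under eq_bigr do rewrite mul1r.
Qed.

End CatalanSum.
End PowerLaw.

(** * The scaled generating functions *)

Section Summable.
Variables (R : realFieldType) (r : R).
Hypothesis r0 : 0 <= r.
Implicit Types f g : fps R.

Definition fps_summable f : Prop := exists M : R, fps_norm_le r f M.

Lemma fps_summableD f g : fps_summable f -> fps_summable g -> fps_summable (f + g).
Proof. by move=> [M fM] [M' gM]; exists (M + M'); exact: fps_norm_leD. Qed.

Lemma fps_summableB f g : fps_summable f -> fps_summable g -> fps_summable (f - g).
Proof.
by move=> fM [M gM]; apply: fps_summableD => //; exists M; exact: fps_norm_leN.
Qed.

Lemma fps_summableM f g : fps_summable f -> fps_summable g -> fps_summable (f * g).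
Proof. by move=> [M fM] [M' gM]; exists (M * M'); exact: fps_norm_leM. Qed.

Lemma fps_summableC x : fps_summable (fpsC x).
Proof. by exists `|x|; exact: fps_norm_leC. Qed.

Lemma fps_summable1 : fps_summable 1.
Proof. by exists 1; exact: fps_norm_le1. Qed.

Lemma fps_summableX k : fps_summable (fpsX R ^+ k).
Proof. by exists (r ^+ k); apply: fps_norm_le_exp => //; exact: fps_norm_leX. Qed.

Lemma fps_summable_sum n (F : nat -> fps R) :
  (forall i, fps_summable (F i)) -> fps_summable (\sum_(i < n) F i).
Proof.
move=> FM; elim: n => [|n IH]; last by rewrite big_ord_recr; exact: fps_summableD.
rewrite big_ord0; exists 0 => N.
by rewrite big1// => i _; rewrite [X in `|X|](_ : _ = 0)// normr0 mul0r.
Qed.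

End Summable.

Lemma le_coef_fpsM (R : realFieldType) (f g : fps R) i j :
  fps_nneg f -> fps_nneg g -> f i * g j <= (f * g) (i + j)%N.
Proof.
move=> f0 g0; have ij : (i < (i + j).+1)%N by rewrite ltnS leq_addr.
rewrite coef_fpsM (bigD1 (Ordinal ij))//= addKn lerDl sumr_ge0// => k _.
by rewrite mulr_ge0.
Qed.

Lemma leq_double_sub (m n : nat) : (2 * m <= n)%N -> (n.+1 <= 2 * (n - m).+1)%N.
Proof. lia. Qed.

Section ScaledPowers.
Variables (R : realType) (rho : R).
Hypotheses (rho0 : 0 < rho) (rho1 : rho < 1).

Definition fpsZ (k : nat) : fps R := fpsC (rho ^+ k) * fpsX R ^+ k.

Lemma coef_fpsZM k f n :
  (fpsZ k * f) n = if (k <= n)%N then rho ^+ k * f (n - k)%N else 0.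
Proof. by rewrite -mulrA coef_fpsCM coef_fpsXnM; case: ifP => //; rewrite mulr0. Qed.

Lemma fpsZ_ge0 k : fps_nneg (fpsZ k).
Proof.
apply: fps_nnegM; first by apply: fps_nnegC; rewrite exprn_ge0 ?ltW.
by apply: fps_nneg_exp; exact: fps_nnegX.
Qed.

Lemma fpsZD j k : fpsZ (j + k) = fpsZ j * fpsZ k.
Proof. by rewrite /fpsZ !exprD fpsCM mulrACA. Qed.

Lemma fpsZM j k : fpsZ (j * k) = fpsZ j ^+ k.
Proof. by rewrite /fpsZ exprMn -exprM -fpsCX -exprM. Qed.

Lemma fpsZ_coef0 k : (0 < k)%N -> fpsZ k 0%N = 0.
Proof. by move=> k0; rewrite -[fpsZ k]mulr1 coef_fpsZM leqNgt k0. Qed.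

Lemma fpsZ_coef k : fpsZ k k = rho ^+ k.
Proof. by rewrite -[fpsZ k]mulr1 coef_fpsZM leqnn subnn mulr1. Qed.

Lemma fps_norm_leZ r k : 0 <= r -> fps_norm_le r (fpsZ k) ((rho * r) ^+ k).
Proof.
move=> r0; rewrite exprMn -[rho ^+ k]ger0_norm; last by rewrite exprn_ge0// ltW.
apply: fps_norm_leM => //; first exact: fps_norm_leC.
by apply: fps_norm_le_exp => //; exact: fps_norm_leX.
Qed.

Lemma sum_coef_fpsZM k f N :
  \sum_(n < N) (fpsZ k * f) n = rho ^+ k * \sum_(n < N - k) f n.
Proof.
elim: N => [|N IH]; first by rewrite !big_ord0 mulr0.
rewrite big_ord_recr IH /= coef_fpsZM; case: leqP => kN.
  by rewrite subSn// big_ord_recr mulrDr.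
have -> : (N - k = 0)%N by apply/eqP; rewrite subn_eq0 ltnW.
have -> : (N.+1 - k = 0)%N by apply/eqP; rewrite subn_eq0.
by rewrite addr0.
Qed.

Definition fps_geo k : fps R := fps_comp (fun=> 1) (fpsZ k).

Section Geo.
Variable k : nat.
Hypothesis k0 : (0 < k)%N.

Lemma fps_geoK : (1 - fpsZ k) * fps_geo k = 1.
Proof. by apply: fps_inv_ones; exact: fpsZ_coef0. Qed.

Lemma fps_geo_ge0 : fps_nneg (fps_geo k).
Proof. exact: fps_nneg_geo (fpsZ_coef0 k0) fps_geoK (@fpsZ_ge0 k). Qed.

Lemma fps_geo0 : fps_geo k 0%N = 1.
Proof. exact: renewal0 (fpsZ_coef0 k0) fps_geoK. Qed.

Lemma fps_geo_gt0 j : 0 < fps_geo k (k * j)%N.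
Proof.
elim: j => [|j IH]; first by rewrite muln0 fps_geo0.
rewrite mulnS; apply: lt_le_trans
  (renewal_super (fpsZ_coef0 k0) (@fpsZ_ge0 k) fps_geoK _ _).
rewrite mulr_gt0//; apply: lt_le_trans
  (renewal_ge (fpsZ_coef0 k0) (@fpsZ_ge0 k) fps_geoK k0).
by rewrite fpsZ_coef exprn_gt0.
Qed.

Lemma fps_norm_le_fps_geo r : 0 <= r -> rho * r < 1 ->
  fps_norm_le r (fps_geo k) (1 - (rho * r) ^+ k)^-1.
Proof.
move=> r0 r1; apply: fps_norm_le_geo (fps_norm_leZ k r0) fps_geoK => //.
by rewrite exprn_ilt1// ?mulr_ge0// ?ltW// -lt0n.
Qed.

End Geo.
End ScaledPowers.

(** * The series of all terms at its singularity *)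

Section TermAnalysis.
Variables (R : realType) (rho : R) (b c e : nat).
Hypotheses (rho0 : 0 < rho) (rho1 : rho < 1).
Hypotheses (b0 : (0 < b)%N) (c0 : (0 < c)%N) (e0 : (0 < e)%N).
Hypothesis gcd1 : gcdn (gcdn b c) e = 1%N.
Hypothesis rhoE : (1 - rho ^+ b) * (1 - rho ^+ c) ^+ 2 = 4 * rho ^+ e.

Let Z := fpsZ rho.
Let V := fps_geo rho b.
Let G := fps_geo rho c.
Let W : fps R := fpsC 4 * (Z e * (G ^+ 2 * V)).
Let K : fps R := fps_comp (fps_catw R) W.

Definition all_terms : fps R := V * G * K.
Let t := all_terms.

Let VE : (1 - Z b) * V = 1. Proof. exact: fps_geoK. Qed.
Let GE : (1 - Z c) * G = 1. Proof. exact: fps_geoK. Qed.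
Let V_ge0 : fps_nneg V. Proof. exact: fps_geo_ge0. Qed.
Let G_ge0 : fps_nneg G. Proof. exact: fps_geo_ge0. Qed.
Let W_ge0 : fps_nneg W.
Proof.
apply: fps_nnegM; first exact: fps_nnegC.
apply: fps_nnegM; first exact: fpsZ_ge0.
by apply: fps_nnegM => //; exact: fps_nneg_exp.
Qed.
Let W0 : W 0%N = 0.
Proof. by rewrite /W coef_fpsCM coef_fpsZM leqNgt e0 mulr0. Qed.

Let rb1 : rho ^+ b < 1. Proof. by rewrite exprn_ilt1// ?ltW// -lt0n. Qed.
Let rc1 : rho ^+ c < 1. Proof. by rewrite exprn_ilt1// ?ltW// -lt0n. Qed.
Let re0 : 0 < rho ^+ e. Proof. exact: exprn_gt0. Qed.

(** The Catalan equation at [W] reads [K = 1 + W * K ^+ 2 / 4]; multiplied by [V], it becomes the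
    quadratic for [t]. *)
Lemma all_termsE : t = V + Z c * t + Z e * (t * t).
Proof.
have KE : K = 1 + fpsC 4^-1 * (W * (K * K)).
  rewrite {1}/K [in LHS]fps_catwE fps_compD.
  by rewrite -(fpsC1 R) !fps_compM// !fps_compC fps_compX.
have WE : fpsC 4^-1 * W = Z e * (G ^+ 2 * V).
  by rewrite /W [LHS]mulrA -fpsCM mulVf ?pnatr_eq0// fpsC1 mul1r.
suff E : (1 - Z c) * t = V + Z e * (t * t).
  have -> : t = (1 - Z c) * t + Z c * t by ring.
  by rewrite {1}E; ring.
have -> : (1 - Z c) * t = (1 - Z c) * G * (V * K) by rewrite /t /all_terms; ring.
rewrite GE mul1r {1}KE mulrDr mulr1 [fpsC _ * _]mulrA WE /t /all_terms; ring.
Qed.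

Let K_ge0 : fps_nneg K.
Proof. by apply: fps_nneg_comp => // n; exact/ltW/catw_gt0. Qed.

Lemma all_terms_ge0 : fps_nneg t.
Proof. by apply: fps_nnegM => //; exact: fps_nnegM. Qed.

(** By the equation for [rho], the bounds on the norms of the factors of [W] multiply to exactly
    1. *)
Let W_norm1 : fps_norm_le 1 W 1.
Proof.
have [rb rc] : (1 - rho ^+ b != 0) /\ (1 - rho ^+ c != 0).
  by split; rewrite gt_eqF// subr_gt0.
have E : (1 : R) = `|4| * ((rho * 1) ^+ e *
    ((1 - (rho * 1) ^+ c)^-1 ^+ 2 * (1 - (rho * 1) ^+ b)^-1)).
  rewrite normr_nat !mulr1 mulrA -rhoE; field; apply/andP; split => //.
rewrite {2}E; apply: fps_norm_leM => //; first exact: fps_norm_leC.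
apply: fps_norm_leM => //; first exact: fps_norm_leZ.
apply: fps_norm_leM => //; last by apply: fps_norm_le_fps_geo => //; rewrite mulr1.
apply: fps_norm_le_exp => //; apply: fps_norm_le_fps_geo => //.
by rewrite mulr1.
Qed.

Let S k : fps R := fpsC (rho ^+ k) * \sum_(i < k) fpsX R ^+ i.

Let ZS k : Z k = fpsC (rho ^+ k) - (1 - fpsX R) * S k.
Proof.
rewrite /Z /fpsZ /S mulrCA -[X in X * \sum_(_ < _) _]opprB mulNr -subrX1; ring.
Qed.

(** The polynomial [(1 - Z b) * (1 - Z c) ^+ 2 - 4 * Z e] vanishes at 1 by the choice of [rho], and
    [Q] is its quotient by [1 - fpsX R]. This explicit form shows that the tail series [T] is
    summable beyond radius 1. *)
Let Q : fps R := S b * (1 - Z c) ^+ 2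
  + fpsC (1 - rho ^+ b) * (S c * (fpsC 2 * fpsC (1 - rho ^+ c) + (1 - fpsX R) * S c))
  + fpsC 4 * S e.

Let T : fps R := Q * (V * G ^+ 2).

Let TE : (1 - fpsX R) * T = 1 - W.
Proof.
have CB x : fpsC (1 - x) = 1 - fpsC x :> fps R.
  by apply/funext => -[|n]; rewrite coef_fpsD coef_fpsN //= subr0.
have rE : (1 - fpsC (rho ^+ b)) * (1 - fpsC (rho ^+ c)) ^+ 2 - fpsC 4 * fpsC (rho ^+ e)
    = 0 :> fps R.
  by rewrite -!CB -fpsCX -!fpsCM rhoE subrr.
have DE : (1 - Z b) * (1 - Z c) ^+ 2 - fpsC 4 * Z e = (1 - fpsX R) * Q.
  apply/eqP; rewrite -subr_eq0; apply/eqP; rewrite -[RHS]rE /Q !ZS !CB.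
  have -> : fpsC 2 = 2 :> fps R by rewrite -[2]/(1 + 1) fpsCD fpsC1.
  ring.
rewrite /T [LHS]mulrA -DE.
have -> : ((1 - Z b) * (1 - Z c) ^+ 2 - fpsC 4 * Z e) * (V * G ^+ 2) =
  ((1 - Z b) * V) * ((1 - Z c) * G) ^+ 2 - W by rewrite /W; ring.
by rewrite VE GE mul1r expr1n.
Qed.

(** [T n] is 1 minus a partial sum of [W]. *)
Let T_ge0 : fps_nneg T.
Proof.
have TS n : T n = 1 - \sum_(i < n.+1) W i.
  elim: n => [|n IH].
    have := congr1 (fun f : fps R => f 0%N) TE.
    by rewrite mulrBl mul1r !coef_fpsD !coef_fpsN coef_fpsXM subr0 big_ord1.
  have := congr1 (fun f : fps R => f n.+1) TE.
  rewrite mulrBl mul1r !coef_fpsD !coef_fpsN coef_fpsXM coef_fps1.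
  rewrite big_ord_recr /= opprD addrA -IH add0r.
  by move: (T n) (T n.+1) (W n.+1) => x y z; lra.
move=> n; rewrite TS subr_ge0; apply: le_trans (W_norm1 n.+1).
by apply: ler_sum => i _; rewrite expr1n mulr1 ler_norm.
Qed.

(* The exponent 16 leaves room for both radii w^3 and w^8 used below. *)
Let w_ex : exists2 w : R, 1 < w & rho * w ^+ 16 = 1.
Proof.
pose x := Num.sqrt (Num.sqrt (Num.sqrt (Num.sqrt rho))).
have x0 : 0 < x by rewrite !sqrtr_gt0.
have xE : x ^+ 16 = rho.
  rewrite -[16%N]/((2 * 2 * 2 * 2)%N) !exprM.
  by rewrite !sqr_sqrtr ?sqrtr_ge0 ?(ltW rho0).
exists x^-1; last by rewrite exprVn xE mulfV// gt_eqF.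
rewrite invf_gt1//; rewrite ltNge; apply/negP => x1.
by have := exprn_ege1 16 x1; rewrite xE leNgt rho1.
Qed.

Section Radius.
Variable r : R.
Hypotheses (r0 : 0 <= r) (rr1 : rho * r < 1).

Let Zsum k : fps_summable r (Z k).
Proof. by exists ((rho * r) ^+ k); exact: fps_norm_leZ. Qed.
Let Vsum : fps_summable r V.
Proof. by eexists; apply: fps_norm_le_fps_geo. Qed.
Let Gsum : fps_summable r G.
Proof. by eexists; apply: fps_norm_le_fps_geo. Qed.
Let Ssum k : fps_summable r (S k).
Proof.
apply: fps_summableM => //; first exact: fps_summableC.
by apply: fps_summable_sum => // i; exact: fps_summableX.
Qed.

Lemma summableVG : fps_summable r (V * G).
Proof. exact: fps_summableM. Qed.

Lemma summableV : fps_summable r V.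
Proof. exact: Vsum. Qed.

Let G2sum : fps_summable r (G ^+ 2).
Proof. by rewrite expr2; exact: fps_summableM. Qed.

Lemma summableW : fps_summable r W.
Proof.
apply: fps_summableM => //; first exact: fps_summableC.
exact: (fps_summableM r0 (Zsum e) (fps_summableM r0 G2sum Vsum)).
Qed.

Lemma summableT : fps_summable r T.
Proof.
apply: fps_summableM => //; last exact: fps_summableM.
have C x := @fps_summableC R r x.
have X1 : fps_summable r (1 - fpsX R).
  by apply: fps_summableB => //; [exact: fps_summable1 | exact: (fps_summableX _ 1)].
have Zc1 : fps_summable r (1 - Z c).
  by apply: fps_summableB => //; exact: fps_summable1.
apply: fps_summableD => //; last exact: fps_summableM.
apply: fps_summableD => //.
  by apply: fps_summableM => //; rewrite expr2; exact: fps_summableM.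
apply: fps_summableM => //; apply: fps_summableM => //.
by apply: fps_summableD => //; exact: fps_summableM.
Qed.

End Radius.

Let U : fps R := fps_comp (fun=> 1) W.
Let UE : (1 - W) * U = 1. Proof. exact: fps_inv_ones. Qed.

Let W_gt0 i j : 0 < W (e + (c * i + b * j))%N.
Proof.
rewrite /W coef_fpsCM coef_fpsZM leq_addr addKn mulr_gt0// mulr_gt0//.
have G2 : fps_nneg (G ^+ 2) by exact: fps_nneg_exp.
apply: lt_le_trans (le_coef_fpsM _ _ G2 V_ge0).
rewrite mulr_gt0//; last exact: fps_geo_gt0.
rewrite expr2 -[(c * i)%N]addn0; apply: lt_le_trans (le_coef_fpsM _ _ G_ge0 G_ge0).
by rewrite mulr_gt0//; [exact: fps_geo_gt0 | rewrite /G fps_geo0].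
Qed.

(** A large [n] splits into [k] jumps of length [e] and one of length [e + c * i + b * j], all of
    positive weight in [W]. *)
Let U_eventually_gt0 : exists N, forall n, (N <= n)%N -> 0 < U n.
Proof.
have [N H] := numerical_semigroup b0 c0 e0 gcd1.
exists N => n /H[k [i [j ->]]]; rewrite mulSn [(e + _)%N]addnC -2!addnA.
elim: k => [|k IH].
  rewrite mul0n add0n; apply: lt_le_trans (W_gt0 i j) _.
  by apply: (renewal_ge W0 W_ge0 UE); rewrite addn_gt0 e0.
rewrite mulSn -addnA; apply: lt_le_trans (renewal_super W0 W_ge0 UE _ _).
rewrite mulr_gt0//; apply: lt_le_trans (renewal_ge W0 W_ge0 UE e0).
by have := W_gt0 0 0; rewrite !muln0 !addn0.
Qed.

Lemma all_terms_upper : fps_pow32 t.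
Proof.
have [w w1 wE] := w_ex; have w0 : 0 < w by exact: lt_trans ltr01 w1.
have wlt k : (k < 16)%N -> rho * w ^+ k < 1.
  by move=> k16; rewrite -wE ltr_pM2l// ltr_eXn2l.
have [M WM] := summableW (exprn_ge0 8 (ltW w0)) (wlt 8%N isT).
have [M' VGM] := summableVG (exprn_ge0 3 (ltW w0)) (wlt 3%N isT).
apply: (fps_pow32_geoM w1 _ VGM); first exact: fps_nnegM.
exact: (catalan_sum_upper W0 W_ge0 UE T_ge0 TE w1 WM).
Qed.

Lemma all_terms_lower : exists2 dl : R, 0 < dl &
  exists N, forall n, (N <= n)%N -> dl * pow32 R n <= t n.
Proof.
have [w w1 wE] := w_ex; have w0 : 0 < w by exact: lt_trans ltr01 w1.
have rw1 : rho * w < 1.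
  by rewrite -wE ltr_pM2l// -{1}[w]expr1 ltr_eXn2l.
have [M TM] := summableT (ltW w0) rw1.
have [dl dl0 [N UN]] := renewal_lower_bound W0 W_ge0 UE T_ge0 TE w1 TM U_eventually_gt0.
exists (dl / 2); first exact: divr_gt0.
exists N => n /UN dlU; have pn := pow32_gt0 R n.
(* The constant coefficient of [V * G] alone yields [K n <= t n]. *)
have VG0 : (V * G) 0%N = 1.
  by rewrite coef_fpsM big_ord1 /V /G !fps_geo0 ?mulr1.
have Kt : K n <= t n.
  rewrite -[K n]mul1r -VG0 -[n in leRHS]add0n; apply: le_coef_fpsM => //.
  exact: fps_nnegM.
apply: le_trans Kt; have := catalan_sum_lower W0 W_ge0 UE n.
have := ler_wpM2l (ltW pn) dlU; rewrite -/K.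
by move: (K n) (pow32 R n) (U n) => x y z; lra.
Qed.

(** At [rho] the quadratic for [t] has zero discriminant, and [tau] is its double root. *)
Let tau : R := (1 - rho ^+ c) / (2 * rho ^+ e).

(** The quadratic bounds a partial sum monotonically in terms of shorter ones, and [tau] is a fixed
    point of this bound. *)
Lemma all_terms_norm : fps_norm_le 1 t tau.
Proof.
have tau0 : 0 <= tau.
  by rewrite /tau divr_ge0 ?mulr_ge0 ?subr_ge0 ?(ltW rc1) ?(ltW re0).
have tauE : (1 - rho ^+ b)^-1 + rho ^+ c * tau + rho ^+ e * (tau * tau) = tau.
  have rb : 1 - rho ^+ b != 0 by rewrite gt_eqF// subr_gt0.
  have re : rho ^+ e != 0 by rewrite gt_eqF.
  have -> : (1 - rho ^+ b)^-1 = (1 - rho ^+ c) ^+ 2 / (4 * rho ^+ e).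
    by rewrite -rhoE; field; rewrite rb subr_eq0 eq_sym lt_eqF.
  by rewrite /tau; field.
suff H N : \sum_(n < N) t n <= tau.
  by move=> N; under eq_bigr do rewrite expr1n mulr1 ger0_norm ?all_terms_ge0//; exact: H.
elim/ltn_ind: N => -[|N] IH; first by rewrite big_ord0.
rewrite -tauE all_termsE.
rewrite (eq_bigr (fun n : 'I_N.+1 => V n + (Z c * t) n + (Z e * (t * t)) n))//.
rewrite !big_split /= !sum_coef_fpsZM.
apply: lerD; [apply: lerD|].
- have VN : fps_norm_le 1 V (1 - (rho * 1) ^+ b)^-1.
    by apply: fps_norm_le_fps_geo => //; rewrite mulr1.
  move: (VN N.+1); rewrite mulr1; apply: le_trans.
  by apply: ler_sum => i _; rewrite expr1n mulr1 ler_norm.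
- rewrite ler_wpM2l ?exprn_ge0 ?(ltW rho0)//; apply: IH.
  by rewrite ltn_subrL c0.
- rewrite ler_wpM2l ?(ltW re0)//.
  apply: le_trans (sum_coef_fpsM_le _ all_terms_ge0 all_terms_ge0) _.
  have HN : \sum_(n < N.+1 - e) t n <= tau by apply: IH; rewrite ltn_subrL e0.
  by apply: ler_pM => //; apply: sumr_ge0 => i _; exact: all_terms_ge0.
Qed.

(** One step of the path to the marked index: an abstraction costs [Z c] and raises the index by
    one, hence [Z b]; an application offers two sides and an arbitrary sibling. *)
Let f : fps R := Z (b + c)%N + fpsC 2 * (Z e * t).
Let h : fps R := V * fps_comp (fun=> 1) f.

Let f0 : f 0%N = 0.
Proof.
rewrite /f coef_fpsD coef_fpsCM coef_fpsZM leqNgt e0 mulr0 addr0.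
by apply: fpsZ_coef0; rewrite addn_gt0 b0.
Qed.

Let f_ge0 : fps_nneg f.
Proof.
apply: fps_nnegD; first exact: fpsZ_ge0.
apply: fps_nnegM; first exact: fps_nnegC.
by apply: fps_nnegM; [exact: fpsZ_ge0 | exact: all_terms_ge0].
Qed.

Let hE : h = V + f * h.
Proof.
have : (1 - f) * h = V by rewrite /h mulrCA fps_inv_ones// mulr1.
by move=> <-; ring.
Qed.

(** As [2 * rho ^+ e * tau = 1 - rho ^+ c], the norm of [f] is at most
    [1 - rho ^+ c * (1 - rho ^+ b) < 1], so [fps_pow32_geo] applies. *)
Lemma excess_pow32 : fps_pow32 h.
Proof.
have [w w1 wE] := w_ex; have w0 : 0 < w by exact: lt_trans ltr01 w1.
have rw3 : rho * w ^+ 3 < 1 by rewrite -wE ltr_pM2l// ltr_eXn2l.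
have [M VM] := summableV (exprn_ge0 3 (ltW w0)) rw3.
apply: (fps_pow32_geoM w1 V_ge0 VM).
pose q := (rho * 1) ^+ (b + c) + `|2| * ((rho * 1) ^+ e * tau).
have q1 : q < 1.
  have -> : q = 1 - rho ^+ c * (1 - rho ^+ b).
    rewrite /q normr_nat !mulr1 exprD /tau; field.
    by rewrite gt_eqF.
  by rewrite ltrBlDr ltrDl mulr_gt0 ?subr_gt0 ?exprn_gt0.
have fq : fps_norm_le 1 f q.
  have Zn k := @fps_norm_leZ _ _ rho0 1 k ler01.
  exact: (fps_norm_leD ler01 (Zn _) (fps_norm_leM ler01 (@fps_norm_leC _ 1 2)
    (fps_norm_leM ler01 (Zn e) all_terms_norm))).
apply: (fps_pow32_geo f0 f_ge0 q1 fq _ (fps_inv_ones f0)).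
have [C C0 tC] := all_terms_upper.
have fpos k : 0 < (k.+1%:R : R) ^+ 3 by rewrite exprn_gt0.
have zC k : fps_pow32 (Z k).
  exists (k.+1%:R ^+ 3) => // n.
  rewrite -[Z k]mulr1 coef_fpsZM; case: leqP => [kn|_]; last first.
    by rewrite mulr_ge0// ltW ?pow32_gt0.
  rewrite coef_fps1; have [E|] := eqVneq (n - k)%N 0%N; last first.
    by rewrite mulr0 mulr_ge0// ltW ?pow32_gt0.
  have -> : n = k by apply/eqP; rewrite eqn_leq kn -subn_eq0 E.
  rewrite mulr1; apply: le_trans (pow32_inv_le R k).
  by apply: exprn_ile1; exact: ltW.
have [C1 C10 zbc] := zC (b + c)%N.
have ztC : fps_pow32 (Z e * t).
  have Zs : fps_norm_le (w ^+ 3) (Z e) ((rho * w ^+ 3) ^+ e).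
    by apply: fps_norm_leZ => //; apply: exprn_ge0; exact: ltW.
  by apply: (fps_pow32_geoM w1 _ Zs); [exact: fpsZ_ge0 | exact: all_terms_upper].
have [C2 C20 zt] := ztC.
exists (C1 + 2 * C2); first by rewrite addr_gt0// mulr_gt0.
move=> n; rewrite /f coef_fpsD coef_fpsCM [leRHS]mulrDl; apply: lerD; first exact: zbc.
by rewrite -mulrA ler_wpM2l.
Qed.

(** * Comparison of m-open terms with all terms *)

Section OpenTerms.
Variable l : nat -> fps R.
Hypothesis l_ge0 : forall m, fps_nneg (l m).
Hypothesis lE : forall m,
  l m = \sum_(j < m) Z (b * j)%N + Z c * l m.+1 + Z e * (l m * l m).

(* A term that is not [m]-open contains an index pointing at least [m] levels
   above the root; [Z (b * m) * h] counts terms with one such marked index. *)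
Lemma open_terms_bounds m n :
  l m n <= t n /\ t n - l m n <= (Z (b * m)%N * h) n.
Proof.
have VmE k : V = \sum_(j < k) Z (b * j)%N + Z (b * k)%N * V.
  rewrite (eq_bigr (fun j : 'I_k => Z b ^+ j)); last by move=> j _; rewrite /Z fpsZM.
  have E : \sum_(j < k) Z b ^+ j = (1 - Z b ^+ k) * V.
    have -> : 1 - Z b ^+ k = (1 - Z b) * \sum_(j < k) Z b ^+ j.
      by rewrite -[LHS]opprB subrX1 -mulNr opprB.
    by rewrite mulrAC VE mul1r.
  by rewrite E /Z fpsZM; ring.
(* [bE] and [hbE] are the same recursion except for the factor [t + l k] against [t + t], and both
   call only smaller coefficients; strong induction on [n], uniform in [m], gives the two bounds
   together. *)
have bE k : t - l k = Z (b * k)%N * V + Z c * (t - l k.+1)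
    + Z e * ((t + l k) * (t - l k)).
  rewrite {1}all_termsE {1}lE {1}(VmE k); ring.
have hbE k : Z (b * k)%N * h = Z (b * k)%N * V + Z c * (Z (b * k.+1)%N * h)
    + Z e * ((t + t) * (Z (b * k)%N * h)).
  rewrite {1}hE /f mulnS /Z !fpsZD.
  have -> : fpsC 2 = 2 :> fps R by rewrite -[2]/(1 + 1) fpsCD fpsC1.
  ring.
elim/ltn_ind: n m => n IH m.
have t0 := all_terms_ge0.
have bV : 0 <= (Z (b * m)%N * V) n by apply: fps_nnegM => //; exact: fpsZ_ge0.
have main : 0 <= (t - l m) n <= (Z (b * m)%N * h) n; last first.
  by move: main; rewrite coef_fpsD coef_fpsN subr_ge0 => /andP[].
have IH1 k i : (i < n)%N -> 0 <= (t - l k) i.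
  by move=> /IH/(_ k)[+ _]; rewrite coef_fpsD coef_fpsN subr_ge0.
have IH2 k i : (i < n)%N -> (t - l k) i <= (Z (b * k)%N * h) i.
  by move=> /IH/(_ k)[].
rewrite bE hbE 4!coef_fpsD; apply/andP; split.
  apply: addr_ge0; first apply: addr_ge0 => //; rewrite coef_fpsZM; case: leqP => // cn.
    rewrite mulr_ge0 ?exprn_ge0 ?(ltW rho0)//; apply: IH1.
    by rewrite ltn_subrL c0 (leq_trans c0).
  rewrite mulr_ge0 ?(ltW re0)// coef_fpsM; apply: sumr_ge0 => i _.
  apply: mulr_ge0; first by rewrite coef_fpsD addr_ge0//; exact: l_ge0.
  apply: IH1; apply: leq_ltn_trans (leq_subr _ _) _.
  by rewrite ltn_subrL e0 (leq_trans e0).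
apply: lerD; first apply: lerD => //; rewrite [leLHS]coef_fpsZM [leRHS]coef_fpsZM;
  case: leqP => // cn.
  rewrite ler_wpM2l ?exprn_ge0 ?(ltW rho0)//; apply: IH2.
  by rewrite ltn_subrL c0 (leq_trans c0).
rewrite ler_wpM2l ?(ltW re0)// !coef_fpsM; apply: ler_sum => i _.
have ne : (n - e < n)%N by rewrite ltn_subrL e0 (leq_trans e0).
have ini : (i < n)%N by apply: leq_ltn_trans ne; rewrite -ltnS.
have nin : (n - e - i < n)%N by apply: leq_ltn_trans ne; exact: leq_subr.
apply: ler_pM.
- exact: (addr_ge0 (t0 i) (l_ge0 m i)).
- exact: IH1.
- rewrite [leLHS]coef_fpsD [leRHS]coef_fpsD lerD2l.
  by have [] := IH _ ini m.
- exact: IH2.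
Qed.

Lemma open_terms_shift m k n : (c * k <= n)%N ->
  rho ^+ (c * k) * l (m + k)%N (n - c * k)%N <= l m n.
Proof.
elim: k m n => [|k IH] m n ckn; first by rewrite muln0 mul1r addn0 subn0.
have ckn' : (c + c * k <= n)%N by rewrite -mulnS.
apply: (@le_trans _ _ (rho ^+ c * l m.+1 (n - c)%N)).
  rewrite mulnS exprD -mulrA ler_wpM2l ?exprn_ge0 ?(ltW rho0)//.
  rewrite addnS -addSn subnDA; apply: IH.
  by rewrite leq_subRL// (leq_trans _ ckn')// leq_addr.
rewrite [leRHS](_ : _ = (\sum_(j < m) Z (b * j)%N + Z c * l m.+1 + Z e * (l m * l m)) n);
  last by rewrite -lE.
rewrite !coef_fpsD coef_fpsZM (leq_trans _ ckn') ?leq_addr//.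
rewrite addrAC lerDr addr_ge0//.
  by rewrite coef_fps_sum sumr_ge0// => j _; exact: fpsZ_ge0.
by apply: fps_nnegM; [exact: fpsZ_ge0 | exact: fps_nnegM].
Qed.

Lemma open_terms_theta m : exists C1 C2 : R, [/\ 0 < C1, 0 < C2 &
  exists N, forall n, (N <= n)%N -> C1 * pow32 R n <= l m n <= C2 * pow32 R n].
Proof.
have [dl dl0 [N tN]] := all_terms_lower.
have [C2 C20 tC] := all_terms_upper.
have [Ch Ch0 hC] := excess_pow32.
have rV : 1 < (rho ^+ b)^-1 by rewrite invf_gt1// exprn_gt0.
(* [M] ensures [rho ^+ (b * M) * (Ch * 8) <= dl / 2], so the terms that are not [k]-open take at
   most half of the lower bound on [t]. The 8 is [2 ^+ 3], lost because [n' - b * k] may be only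
   about half of [n']. *)
have [M MH] := le_exp_archi (Ch * 8 * 2 / dl) rV.
pose k := (m + M)%N.
exists (rho ^+ (c * M) * (dl / 2)), C2; split => //.
  by rewrite mulr_gt0 ?exprn_gt0 ?divr_gt0.
exists (c * M + (N + 2 * (b * k)))%N => n nN.
have cn : (c * M <= n)%N by rewrite (leq_trans _ nN)// leq_addr.
apply/andP; split; last by apply: le_trans (tC n); have [] := open_terms_bounds m n.
apply: le_trans (open_terms_shift m cn); rewrite -mulrA ler_wpM2l//.
  by rewrite exprn_ge0 ?ltW.
set n' := (n - c * M)%N.
have nn' : (N + 2 * (b * k) <= n')%N by rewrite /n' leq_subRL.
apply: (@le_trans _ _ (dl / 2 * pow32 R n')).
  rewrite ler_wpM2l ?divr_ge0 ?(ltW dl0)//.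
  by apply: pow32_antimono; exact: leq_subr.
have [_] := open_terms_bounds k n'.
have tn : dl * pow32 R n' <= t n' by apply: tN; rewrite (leq_trans _ nn')// leq_addr.
have bk : (b * k <= n')%N.
  by rewrite (leq_trans _ nn')// (leq_trans _ (leq_addl _ _))// leq_pmull.
rewrite coef_fpsZM bk.
have p0 := pow32_gt0 R n'.
have hn : h (n' - b * k)%N <= Ch * (8 * pow32 R n').
  apply: le_trans (hC _) _; rewrite ler_wpM2l ?(ltW Ch0)//.
  have -> : 8 = 2%:R ^+ 3 :> R by ring.
  apply: pow32_lin_le.
  by apply: leq_double_sub; rewrite (leq_trans _ nn')// leq_addl.
have rk : rho ^+ (b * k) * (Ch * 8) <= dl / 2.
  have MH' : rho ^+ (b * M) * (Ch * 8 * 2) <= dl.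
    rewrite exprVn -exprM ler_pdivrMr// [leRHS]mulrC ler_pdivlMr ?exprn_gt0// in MH.
    by rewrite mulrC.
  have : rho ^+ (b * k) <= rho ^+ (b * M).
    rewrite ler_wiXn2l ?(ltW rho0) ?(ltW rho1)//.
    by rewrite leq_mul2l leq_addl orbT.
  move=> /(ler_wpM2r (mulr_ge0 (ltW Ch0) (ler0n R 8))).
  by move: MH'; move: (rho ^+ (b * k)) (rho ^+ (b * M)) => x y; lra.
have : rho ^+ (b * k) * h (n' - b * k)%N <= dl / 2 * pow32 R n'.
  have r0 : 0 <= rho ^+ (b * k) by rewrite exprn_ge0 ?ltW.
  apply: le_trans (ler_wpM2l r0 hn) _.
  have := ler_wpM2r (ltW p0) rk; rewrite !mulrA //.
rewrite -/k; move: (rho ^+ (b * k) * _) tn.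
by move: (dl) (pow32 R n') (t n') (l k n') => x y z s v; lra.
Qed.

End OpenTerms.
End TermAnalysis.

(** * Counting terms *)

Section Counting.
Local Open Scope nat_scope.

(** Enclosing abstractions only enlarge the allowance, which turns the body of an m-open abstraction
    into an [m.+1]-open term. *)
Lemma open_underE m k t : open_under m k t = m_open (m + k) t.
Proof.
rewrite /m_open; suff E i : open_under m (k + i) t = open_under (m + k) i t.
  by rewrite -[k in LHS]addn0.
elim: t i => [j | u IH | u IHu v IHv] i /=; first by lia.
- by rewrite -addnS IH.
- by rewrite IHu IHv.
Qed.

Variables a b c d : nat.
Hypotheses (had : 1 <= a + d) (hb : 1 <= b) (hc : 1 <= c).

Fixpoint term_height (t : term) : nat :=
  match t with
  | Var _ => 0
  | Lam u => (term_height u).+1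
  | App u v => (maxn (term_height u) (term_height v)).+1
  end.

(** An application adds [d] and the size of its shallower subterm to the deeper one, at least
    [a + d >= 1]. *)
Lemma term_height_le t : term_height t <= term_size a b c d t.
Proof.
elim: t => //= [u | u IHu v IHv]; first by lia.
have := term_size_ge a b c d u; have := term_size_ge a b c d v; lia.
Qed.


Definition app_terms (F : nat -> seq term) n : seq term :=
  if d <= n then
    [seq t | i <- index_iota 0 (n - d).+1,
             t <- [seq App u v | u <- F i, v <- F (n - d - i)]]
  else [::].

Lemma app_termsP F n t : reflect
  (exists i u v, [/\ d + i <= n, u \in F i, v \in F (n - d - i) & t = App u v])
  (t \in app_terms F n).
Proof.
rewrite /app_terms; case: leqP => dn; last first.
  by apply: (iffP idP) => // -[i [u [v []]]]; lia.
apply: (iffP allpairsPdep) => [[i [t' [iI /allpairsP[[u v] [uI vI ->]] ->]]]|].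
  by exists i, u, v; split => //; move: iI; rewrite mem_index_iota; lia.
move=> [i [u [v [di uI vI ->]]]]; exists i, (App u v); split => //.
  by rewrite mem_index_iota; lia.
by apply/allpairsP; exists (u, v).
Qed.

(** The fuel [h] bounds the height. Recursion on the size would not do: for [d = 0] an application
    calls the list of size [n] again. *)
Fixpoint enum_terms (h m n : nat) : seq term :=
  if h is h'.+1 then
    [seq Var j | j <- iota 0 m & a + b * j == n] ++
    (if c <= n then [seq Lam u | u <- enum_terms h' m.+1 (n - c)] else [::]) ++
    app_terms (enum_terms h' m) n
  else [::].

Lemma mem_enum_terms h m n t : (t \in enum_terms h m n) =
  [&& m_open m t, term_size a b c d t == n & term_height t < h].
Proof.
elim: h m n t => [|h IH] m n t; first by rewrite !andbF.
rewrite /= !mem_cat; case: t => [j | u | u v].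
- rewrite (_ : (Var j \in _) = (j < m) && (a + b * j == n)); last first.
    apply/mapP/idP => [[i] | jmn]; last by
      exists j; rewrite ?mem_filter ?mem_iota//; lia.
    by rewrite mem_filter mem_iota => imn [->]; lia.
  rewrite [X in _ || (X || _)](_ : _ = false) /=; last first.
    by case: leqP => // _; apply/mapP => -[].
  rewrite [X in _ || X](_ : _ = false) /=; last by apply/app_termsP => -[? [? [? []]]].
  by rewrite /m_open /= index_sizeE orbF andbT; congr (_ && _); lia.
- rewrite [X in X || _](_ : _ = false) /=; last by apply/mapP => -[].
  rewrite [X in _ || X](_ : _ = false) ?orbF; last by apply/app_termsP => -[? [? [? []]]].
  rewrite /m_open /= open_underE addn1 ltnS; case: (leqP c n) => cn.
    rewrite mem_map ?IH; last by move=> ? ? [].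
    by congr [&& _, _ & _]; lia.
  by apply/esym/negbTE/negP => /and3P[_ /eqP]; lia.
- rewrite [X in X || _](_ : _ = false) /=; last by apply/mapP => -[].
  rewrite [X in X || _](_ : _ = false) /=; last first.
    by case: leqP => // _; apply/mapP => -[].
  rewrite /m_open /= ltnS.
  apply/app_termsP/and3P => [[i [x [y [iI + + [-> ->]]]]] |].
    rewrite !IH /m_open.
    by move=> /and3P[-> /eqP su hu] /and3P[-> /eqP sv hv]; split => //; lia.
  move=> [/andP[mu mv] /eqP suv huv]; exists (term_size a b c d u), u, v.
  by split; rewrite ?IH /m_open ?mu ?mv //=; lia.
Qed.

Lemma enum_terms_uniq h m n : uniq (enum_terms h m n).
Proof.
elim: h m n => // h IH m n /=; rewrite !cat_uniq; apply/and5P; split.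
- by rewrite map_inj_uniq ?filter_uniq ?iota_uniq// => ? ? [].
- apply/hasPn => t; rewrite mem_cat => /orP[].
    by case: leqP => // _ /mapP[u _ ->]; apply/mapP => -[].
  by move=> /app_termsP[? [? [? [_ _ _ ->]]]]; apply/mapP => -[].
- by case: leqP => // _; rewrite map_inj_uniq// => ? ? [].
- apply/hasPn => t /app_termsP[? [? [? [_ _ _ ->]]]].
  by case: leqP => // _; apply/mapP => -[].
- rewrite /app_terms; case: leqP => // _; apply: allpairs_uniq_dep.
  + exact: iota_uniq.
  + by move=> i _; apply: allpairs_uniq => // -[? ?] [? ?] _ _ /= [-> ->].
  + move=> p q /allpairsPdep[i [t [_ + ->]]] /allpairsPdep[i' [t' [_ + ->]]].
    move=> /allpairsP[[x y] [/= + _ ->]] /allpairsP[[x' y'] [/= + _ ->]].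
    by rewrite !mem_enum_terms => /and3P[_ /eqP <- _] /and3P[_ /eqP <- _] /= [-> ->].
Qed.

Lemma num_open_termsE h m n : n < h ->
  num_open_terms a b c d m n = size (enum_terms h m n).
Proof.
move=> nh; rewrite /num_open_terms.
have -> : fset_set (open_terms a b c d m n) = [fset t in enum_terms h m n]%fset.
  apply/fsetP => t; rewrite in_fset_set; last exact: finite_open_terms.
  rewrite in_fset /= mem_enum_terms.
  apply/idP/and3P => [|[mt /eqP st ht]]; last by rewrite inE.
  rewrite inE => -[mt st]; split; rewrite ?mt ?st//.
  by rewrite (leq_ltn_trans (term_height_le t))// st.
by rewrite card_fseq undup_id// enum_terms_uniq.
Qed.

Local Notation L := (num_open_terms a b c d).

Lemma num_open_terms_rec m n :
  L m n = (\sum_(j < m) (a + b * j == n)) + (if c <= n then L m.+1 (n - c) else 0)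
    + (if d <= n then \sum_(i < (n - d).+1) L m i * L m (n - d - i) else 0).
Proof.
(* Any fuel above the size gives the full count, so [h.+1] on the left agrees with [h] in the
   recursive calls. *)
have [h nh] : exists h, n < h by exists n.+1.
rewrite (@num_open_termsE h.+1)/=; last exact: ltnW.
rewrite !size_cat addnA /app_terms; congr (_ + _ + _).
- rewrite size_map size_filter -sum1_count big_mkcond /=.
  rewrite -(big_mkord xpredT (fun j => nat_of_bool (a + b * j == n))).
  by rewrite /index_iota subn0; apply: eq_bigr => j _; case: eqP.
- by case: (leqP c n) => // cn; rewrite size_map -num_open_termsE//; lia.
- case: (leqP d n) => // dn; rewrite size_allpairs_dep sumnE big_map.
  rewrite -(big_mkord xpredT (fun i => L m i * L m (n - d - i))).
  rewrite big_seq [RHS]big_seq; apply: eq_bigr => i.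
  rewrite mem_index_iota size_allpairs => ?.
  by rewrite -!num_open_termsE//; lia.
Qed.

Lemma num_open_terms_lt m n : n < a -> L m n = 0.
Proof.
move=> na; rewrite (@num_open_termsE n.+1)//; apply/eqP; rewrite size_eq0.
apply/eqP; case E : enum_terms => [//|t s].
have : t \in enum_terms n.+1 m n by rewrite E mem_head.
by rewrite mem_enum_terms => /and3P[_ /eqP + _]; have := term_size_ge a b c d t; lia.
Qed.

End Counting.

(** * From the counting recurrence to the scaled functional equations *)

Section ScaledCounting.
Variables (R : realType) (rho : R) (a b c d : nat).
Hypotheses (rho0 : 0 < rho) (rho1 : rho < 1).
Hypotheses (had : (1 <= a + d)%N) (hb : (1 <= b)%N) (hc : (1 <= c)%N).

Let Z := fpsZ rho.

Lemma fpsZ_coefE k n : fpsZ rho k n = rho ^+ n * (k == n)%:R.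
Proof.
rewrite -[fpsZ rho k]mulr1 coef_fpsZM coef_fps1.
have [kn|nk|->] := ltngtP k n; rewrite ?subnn ?mulr0 ?mulr1//.
by rewrite gtn_eqF ?mulr0// subn_gt0.
Qed.

Lemma fpsZ_inj k : injective ( *%R (Z k)).
Proof.
move=> f g fg; apply/funext => n.
have := congr1 (fun h : fps R => h (n + k)%N) fg.
rewrite !coef_fpsZM leq_addl addnK; apply: mulfI.
by rewrite expf_neq0// gt_eqF.
Qed.

(* Sizes are shifted by [a]: no term is smaller than [a], and the recurrence
   then depends on [a] and [d] through [a + d] only. *)
Definition scaled_count m : fps R :=
  fun n => rho ^+ n * (num_open_terms a b c d m (n + a))%:R.

Lemma scaled_count_ge0 m : fps_nneg (scaled_count m).
Proof. by move=> n; rewrite mulr_ge0// exprn_ge0 ?ltW. Qed.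

Lemma scaled_countE m : scaled_count m = \sum_(j < m) Z (b * j)%N
  + Z c * scaled_count m.+1 + Z (a + d)%N * (scaled_count m * scaled_count m).
Proof.
(* [F] is the series without the shift by [a], for which the recurrence is direct; substituting
   [F k = Z a * scaled_count k] leaves a common factor [Z a] to cancel. *)
pose F k : fps R := fun n => rho ^+ n * (num_open_terms a b c d k n)%:R.
have FE k : F k = Z a * scaled_count k.
  apply/funext => n; rewrite coef_fpsZM /F /scaled_count.
  case: leqP => [an|na]; last by rewrite num_open_terms_lt// mulr0.
  by rewrite subnK// mulrA -exprD subnKC.
have rec : F m = Z a * \sum_(j < m) Z (b * j)%N + Z c * F m.+1 + Z d * (F m * F m).
  apply/funext => n; rewrite /F (num_open_terms_rec had hb hc) !natrD !mulrDr.
  rewrite !coef_fpsD; congr (_ + _ + _).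
  - rewrite mulr_sumr coef_fps_sum natr_sum mulr_sumr; apply: eq_bigr => j _.
    by rewrite /Z -fpsZD fpsZ_coefE.
  - rewrite coef_fpsZM; case: leqP => cn; last by rewrite mulr0.
    by rewrite mulrA -exprD subnKC.
  - rewrite coef_fpsZM; case: leqP => dn; last by rewrite mulr0.
    rewrite coef_fpsM natr_sum !mulr_sumr; apply: eq_bigr => i _.
    rewrite natrM mulrACA -exprD subnKC; last by rewrite -ltnS.
    by rewrite [RHS]mulrA -exprD subnKC.
apply: (@fpsZ_inj a); rewrite -FE rec !FE /Z fpsZD; ring.
Qed.

End ScaledCounting.

(** * The dominant singularity, upper and lower limits, and the final estimate *)

Lemma sing_poly_root_lt1 (R : realType) (a b c d : nat) (rho : R) :
  (1 <= a + d)%N -> (1 <= b)%N -> (1 <= c)%N ->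
  smallest_positive_root (sing_poly R a b c d) rho ->
  [/\ 0 < rho, rho < 1 &
    (1 - rho ^+ b) * (1 - rho ^+ c) ^+ 2 = 4 * rho ^+ (a + d)].
Proof.
move=> had hb hc [rho0 rrho rmin].
have evalE x : (sing_poly R a b c d).[x] =
    (1 - x ^+ b) * (1 - x ^+ c) ^+ 2 - 4 * x ^+ (a + d).
  by rewrite /sing_poly !hornerE.
(* The sign change between 0 and 1 yields a root strictly inside, and [rho] is at most that root. *)
have p1 : (sing_poly R a b c d).[1] < 0 by rewrite evalE !expr1n; lra.
have p0 : 0 < (sing_poly R a b c d).[0].
  by rewrite evalE !expr0n !gtn_eqF//= expr1n; lra.
split => //; last first.
  by apply/eqP; rewrite -subr_eq0 -evalE.
have [x x01 xr] : exists2 x, 0 <= x <= 1 & root (- sing_poly R a b c d) x.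
  by apply: poly_ivt => //; rewrite !hornerN; lra.
rewrite rootN in xr; case/andP: x01 => x0 x1.
have x0' : 0 < x.
  rewrite lt0r x0 andbT; apply/eqP => E; move: xr p0.
  by rewrite E rootE => /eqP ->; rewrite ltxx.
apply: le_lt_trans (rmin _ x0' xr) _; rewrite lt_neqAle x1 andbT.
by apply/eqP => E; move: xr p1; rewrite E rootE => /eqP ->; rewrite ltxx.
Qed.

Lemma limn_esup_le_near (R : realType) (u : (\bar R)^nat) (l : \bar R) (N : nat) :
  (forall n, (N <= n)%N -> (u n <= l)%E) -> (limn_esup u <= l)%E.
Proof.
move=> uN; apply: (@le_trans _ _ (ereal_sup (u @` [set n | (N <= n)%N])))%classic.
  apply: ereal_inf_lbound; exists [set n | (N <= n)%N]%classic => //.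
  exact: nbhs_infty_ge.
by apply: ge_ereal_sup => _ [n /= Nn <-]; exact: uN.
Qed.

Lemma limn_einf_ge_near (R : realType) (u : (\bar R)^nat) (l : \bar R) (N : nat) :
  (forall n, (N <= n)%N -> (l <= u n)%E) -> (l <= limn_einf u)%E.
Proof.
move=> uN; rewrite /limn_einf leeNr; apply: (@limn_esup_le_near _ _ _ N) => n Nn.
by rewrite leeN2; exact: uN.
Qed.

Lemma powR_pow32 (R : realType) (n : nat) :
  n.+1%:R `^ (- (3%:R / 2%:R)) = pow32 R n.
Proof.
by rewrite powRN mulrC powRrM powR12_sqrt// powR_mulrn ?sqrtr_ge0.
Qed.

Theorem theorem1 (R : realType) (a b c d m : nat)
    (had : (1 <= a + d)%N) (hb : (1 <= b)%N) (hc : (1 <= c)%N)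
    (hgcd : gcdn (gcdn b c) (a + d) = 1%N)
    (rho : R) (hrho : smallest_positive_root (sing_poly R a b c d) rho) :
  exists Clow Cup : R,
    [/\ 0 < Clow, 0 < Cup,
        (1%:E <= limn_einf (fun n : nat =>
           ((num_open_terms a b c d m n)%:R /
            (Clow * (n%:R `^ (- (3%:R / 2%:R))) * rho ^- n))%:E))%E
      & (limn_esup (fun n : nat =>
           ((num_open_terms a b c d m n)%:R /
            (Cup * (n%:R `^ (- (3%:R / 2%:R))) * rho ^- n))%:E) <= 1%:E)%E].
Proof.
have [rho0 rho1 rhoE] := sing_poly_root_lt1 had hb hc hrho.
have [C1 [C2 [C10 C20 [N lN]]]] := open_terms_theta rho0 rho1 hb hc had hgcd rhoE
  (scaled_count_ge0 a b c d rho0) (scaled_countE rho0 had hb hc) m.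
have ra0 : 0 < rho ^+ a by exact: exprn_gt0.
have scale n (x : R) : (a <= n)%N ->
    rho ^+ (n - a) * x = rho ^+ n * x / rho ^+ a.
  by move=> an; rewrite -{2}(subnKC an) exprD; field; rewrite gt_eqF.
have bounds n : (N + a < n)%N ->
  C1 * pow32 R (n - a) <= rho ^+ (n - a) * (num_open_terms a b c d m n)%:R
    <= C2 * pow32 R (n - a).
  move=> Nn; have an : (a <= n)%N by lia.
  have := lN (n - a)%N; rewrite /scaled_count subnK//; apply; lia.
(* The factor [rho ^+ a] undoes the shift of sizes by [a]; 8 and [(a + 1)^3] are the costs of
   comparing [n^(-3/2)] with [pow32 R (n - a)]. *)
exists (C1 / 8 * rho ^+ a), (C2 * a.+1%:R ^+ 3 * rho ^+ a); split.
- by rewrite mulr_gt0// divr_gt0.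
- by rewrite !mulr_gt0// exprn_gt0.
(* The threshold excludes size 0, and at size [n.+1] the power in the statement is [pow32 R n]. *)
- apply: (@limn_einf_ge_near _ _ _ (N + a).+1) => -[//|n] Nn.
  have /andP[lo _] := bounds _ Nn.
  rewrite lee_fin powR_pow32 ler_pdivlMr; last first.
    by rewrite !mulr_gt0 ?pow32_gt0 ?invr_gt0 ?exprn_gt0.
  rewrite mul1r ler_pdivrMr ?exprn_gt0//.
  have : pow32 R n <= 2%:R ^+ 3 * pow32 R (n.+1 - a).
    by apply: pow32_lin_le; lia.
  move: lo; rewrite scale; last by lia.
  rewrite ler_pdivlMr// => lo le8.
  have := ler_wpM2l (ltW ra0) (ler_wpM2l (ltW C10) le8).
  move: lo; rewrite [rho ^+ n.+1 * _]mulrC.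
  have -> : (2%:R : R) ^+ 3 = 8 by ring.
  by move: (_ * rho ^+ n.+1) (rho ^+ a) (pow32 R n) (pow32 R _) (C1) => x y z s v; lra.
- apply: (@limn_esup_le_near _ _ _ (N + a).+1) => -[//|n] Nn.
  have /andP[_ up] := bounds _ Nn.
  rewrite lee_fin powR_pow32 ler_pdivrMr; last first.
    by rewrite !mulr_gt0 ?pow32_gt0 ?invr_gt0 ?exprn_gt0.
  rewrite mul1r ler_pdivlMr ?exprn_gt0//.
  have : pow32 R (n.+1 - a) <= a.+1%:R ^+ 3 * pow32 R n.
    by apply: pow32_lin_le; nia.
  move: up; rewrite scale; last by lia.
  rewrite ler_pdivrMr// => up le8.
  have := ler_wpM2l (ltW ra0) (ler_wpM2l (ltW C20) le8).
  move: up; rewrite [rho ^+ n.+1 * _]mulrC.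
  move: (_ * rho ^+ n.+1) (rho ^+ a) (pow32 R n) (pow32 R _) (C2) (_ ^+ 3).
  by move=> x y z s v r; lra.
Qed.
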